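(* Let $P$ be a set of $n$ points in $\mathbb{R}^3$ and $\Delta$ a fixed triangle. Then the number of triangles with vertices in $P$ that are similar to $\Delta$ is $O(n^{15/7})$. *)

(* Defs.v *)
From Stdlib Require Import Reals List Permutation.
Import ListNotations.
Open Scope R_scope.

Definition point : Type := (R * R * R)%type.

Definition dist3 (u v : point) : R :=
  let '(x1, y1, z1) := u in
  let '(x2, y2, z2) := v in
  sqrt ((x1 - x2) ^ 2 + (y1 - y2) ^ 2 + (z1 - z2) ^ 2).

Definition tri : Type := (point * point * point)%type.

Definition verts (t : tri) : list point :=
  let '(a, b, c) := t in [a; b; c].

Definition nondegenerate (t : tri) : Prop :=
  let '(a, b, c) := t in
  dist3 a c < dist3 a b + dist3 b c /\
  dist3 a b < dist3 a c + dist3 c b /\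
  dist3 b c < dist3 b a + dist3 a c.

Definition similar_labelled (t d : tri) : Prop :=
  let '(a, b, c) := t in
  let '(p, q, r) := d in
  exists lam : R, 0 < lam /\
    dist3 a b = lam * dist3 p q /\
    dist3 b c = lam * dist3 q r /\
    dist3 c a = lam * dist3 r p.

Definition similar (t d : tri) : Prop :=
  exists t' : tri, Permutation (verts t) (verts t') /\ similar_labelled t' d.

(* Main.v *)
(* For distinct a, b the points c such that abc is similar to the given triangle
   form a circle with axis ab, so we count incidences of the n points with about
   n^2 circles.  Put D = n^(1/7).  There are polynomials of total degree O(D)
   whose sign vectors split the points into cells with only n^3/D^6 triples of
   points inside a cell.

   A circle contained in no zero set meets O(D) cells, hence it either has O(D)
   points or many triples inside cells; since three points lie on the circles of
   at most two pairs (a, b), these circles give O(D n^2 + n^3/D^6) = O(n^(15/7)) incidences.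
   If a circle lies on Z(f), its tangent at c is orthogonal to the gradient of f
   at c, that is, the gradient lies in the plane abc.  When it is nonzero, this
   leaves only O(n) pairs (a, b) for each c; when it vanishes, one passes to the
   derivatives of f.

   The partition is found without the ham sandwich theorem.  For a space V of
   polynomials whose dimension is a large multiple of the effective number of
   cells, put the evaluation vectors of the points, up to positive factors and up
   to a set of points on which some element of V vanishes, in nearly isotropic
   position.  The values of a random sign combination f are then nearly
   uncorrelated inside the cells, so that the sign of f separates a positive
   proportion of the pairs of points of the same cell.  Since the dimension is
   governed by the current number of triples, repeating this with geometrically
   increasing degrees loses only a constant factor in the total degree. *)

From mathcomp Require Import all_boot all_order all_algebra.
From mathcomp Require Import boolp reals Rstruct ring lra zify polyrcf.
From Stdlib Require Reals Lra List Permutation.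
Require Import Defs.

Set Implicit Arguments.
Unset Strict Implicit.
Unset Printing Implicit Defensive.

Import Order.TTheory GRing.Theory Num.Theory.
Local Open Scope ring_scope.

(** * Gram matrices and isotropic position *)

Definition dot (R : pzSemiRingType) (d : nat) (u v : 'rV[R]_d) : R := (u *m v^T) 0 0.

Section Dot.
Variables (R : comPzRingType) (d : nat).
Implicit Types u v w : 'rV[R]_d.

Lemma dotC u v : dot u v = dot v u.
Proof. by rewrite /dot -[u *m v^T]trmxK trmx_mul trmxK mxE. Qed.

Lemma dotDl u u' v : dot (u + u') v = dot u v + dot u' v.
Proof. by rewrite /dot mulmxDl mxE. Qed.

Lemma dotZl a u v : dot (a *: u) v = a * dot u v.
Proof. by rewrite /dot -scalemxAl mxE. Qed.

Lemma dotZr a u v : dot u (a *: v) = a * dot u v.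
Proof. by rewrite !(dotC u) dotZl. Qed.

Lemma dot0l v : dot 0 v = 0.
Proof. by rewrite /dot mul0mx mxE. Qed.

Lemma dotNl u v : dot (- u) v = - dot u v.
Proof. by rewrite /dot mulNmx mxE. Qed.

Lemma dot_suml (I : Type) (s : seq I) (P : pred I) (F : I -> 'rV[R]_d) v :
  dot (\sum_(i <- s | P i) F i) v = \sum_(i <- s | P i) dot (F i) v.
Proof. by rewrite /dot mulmx_suml summxE. Qed.

Lemma dot_sumr (I : Type) (s : seq I) (P : pred I) (F : I -> 'rV[R]_d) v :
  dot v (\sum_(i <- s | P i) F i) = \sum_(i <- s | P i) dot v (F i).
Proof. by rewrite dotC dot_suml; apply: eq_bigr => i _; rewrite dotC. Qed.

Lemma mul_row_rank1 u v w : u *m (v^T *m w) = dot u v *: w.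
Proof. by rewrite mulmxA [u *m v^T]mx11_scalar mul_scalar_mx. Qed.

End Dot.

Definition gram (R : pzSemiRingType) (T : finType) (d : nat) (v : T -> 'rV[R]_d)
  (w : T -> R) : 'M[R]_d := \sum_x w x *: ((v x)^T *m v x).

Section Gram.
Variables (R : realFieldType) (T : finType) (d : nat) (v : T -> 'rV[R]_d).
Implicit Types (w : T -> R) (u : 'rV[R]_d) (M : 'M[R]_d).

Lemma gram_sym w : (gram v w)^T = gram v w.
Proof.
apply/matrixP => i j; rewrite mxE !summxE; apply: eq_bigr => x _.
by rewrite !mxE; congr (_ * _); apply: eq_bigr => k _; rewrite !mxE mulrC.
Qed.

Lemma mul_gram w u : u *m gram v w = \sum_x (w x * dot u (v x)) *: v x.
Proof.
rewrite /gram mulmx_sumr; apply: eq_bigr => x _.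
by rewrite -scalemxAr mul_row_rank1 scalerA.
Qed.

Lemma dot_gram w u u' : dot (u *m gram v w) u' = \sum_x w x * dot u (v x) * dot (v x) u'.
Proof. by rewrite mul_gram dot_suml; apply: eq_bigr => x _; rewrite dotZl. Qed.

(** For [u] in the kernel, [dot (u *m gram v w) u] is the weighted sum of the squares of the
    [dot u (v x)], so each term of positive weight vanishes. *)
Lemma gram_singular w : (forall x, 0 <= w x) -> gram v w \notin unitmx ->
  exists2 u, u != 0 & forall x, 0 < w x -> dot u (v x) = 0.
Proof.
move=> w0; rewrite -row_free_unit -kermx_eq0 => /rowV0Pn[u /sub_kermxP uM u0].
exists u => // x wx0.
have : \sum_x w x * dot u (v x) ^+ 2 = 0.
  have := dot_gram w u u; rewrite uM dot0l => /esym e; rewrite -[RHS]e.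
  by apply: eq_bigr => y _; rewrite -mulrA expr2 [dot (v y) u]dotC.
move/psumr_eq0P => /(_ (fun y _ => mulr_ge0 (w0 y) (sqr_ge0 _)) x isT) /eqP.
by rewrite mulf_eq0 gt_eqF //= sqrf_eq0 => /eqP.
Qed.

Lemma dot_inv_ge0 w u : (forall x, 0 <= w x) -> gram v w \in unitmx ->
  0 <= dot (u *m invmx (gram v w)) u.
Proof.
move=> w0 Mu; set y := u *m _.
have -> : u = y *m gram v w by rewrite mulmxKV.
rewrite dotC dot_gram; apply: sumr_ge0 => x _.
by rewrite -mulrA [dot (v x) y]dotC -expr2 mulr_ge0 ?sqr_ge0.
Qed.

(** The matrix determinant lemma: the block matrix with rows [1, a] and [- q, 1] factors in two
    ways, whose determinants are compared. *)
Lemma det_rank1 M (c : R) u : M \in unitmx ->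
  \det (M + c *: (u^T *m u)) = \det M * (1 + c * dot (u *m invmx M) u).
Proof.
move=> Mu.
have -> : M + c *: (u^T *m u) = (1%:M + c *: (u^T *m (u *m invmx M))) *m M.
  by rewrite mulmxDl mul1mx -scalemxAl -!mulmxA mulVmx // mulmx1.
rewrite det_mulmx mulrC; congr (_ * _).
set q := u *m invmx M; set a := c *: u^T.
have -> : c *: (u^T *m q) = a *m q by rewrite scalemxAl.
have e1 : block_mx 1%:M a (- q) 1%:M =
   block_mx 1%:M 0 (- q) 1%:M *m block_mx 1%:M a 0 (1%:M + q *m a) :> 'M_(d + 1).
  rewrite mulmx_block !mul1mx !mul0mx !mulmx1 !addr0 mulNmx.
  by rewrite addrCA addNr addr0.
have e2 : block_mx 1%:M a (- q) 1%:M =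
   block_mx (1%:M + a *m q) a 0 1%:M *m block_mx 1%:M 0 (- q) 1%:M :> 'M_(d + 1).
  rewrite mulmx_block !mulmx1 !mul0mx !mul1mx !mulmx0 !add0r mulmxN.
  by rewrite -addrA subrr addr0.
have := congr1 determinant e1; rewrite e2 !det_mulmx !det_ublock !det_lblock.
rewrite !det1 !mul1r !mulr1 => ->.
rewrite det_mx11 mxE mxE /= mulr1n; congr (1 + _).
by rewrite /a -scalemxAr mxE.
Qed.

Lemma gram_set w x (a : R) :
  gram v (fun y => if y == x then w y + a else w y) = gram v w + a *: ((v x)^T *m v x).
Proof.
rewrite /gram (bigD1 x) //= eqxx [in RHS](bigD1 x) //= scalerDl addrAC; congr (_ + _ + _).
by apply: eq_bigr => y /negbTE ->.
Qed.

(** Weights are raised one point at a time; each rank one update multiplies the determinant by a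
    factor at least 1. *)
Lemma gram_mono w w' : (forall x, 0 <= w x <= w' x) -> gram v w \in unitmx ->
  `|\det (gram v w)| <= `|\det (gram v w')| /\ gram v w' \in unitmx.
Proof.
move=> ww' Mu.
pose W (s : seq T) := fun y => if y \in s then w' y else w y.
suff H s : uniq s -> `|\det (gram v w)| <= `|\det (gram v (W s))| /\ gram v (W s) \in unitmx.
  have /H := enum_uniq T.
  have -> : gram v (W (enum T)) = gram v w'.
    by apply: eq_bigr => y _; rewrite /W mem_enum.
  by [].
elim: s => [_|x s IH /= /andP[xs us]].
  have -> : gram v (W [::]) = gram v w by apply: eq_bigr.
  by [].
have [le1 u1] := IH us.
have e : gram v (W (x :: s)) = gram v (W s) + (w' x - w x) *: ((v x)^T *m v x).
  rewrite -gram_set; apply: eq_bigr => y _; congr (_ *: _).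
  rewrite /W inE; case: eqVneq => [->|] //=.
  by rewrite (negbTE xs) addrC subrK.
have W0 y : 0 <= W s y.
  by rewrite /W; have /andP[p q] := ww' y; case: ifP => // _; apply: le_trans q.
have t0 := dot_inv_ge0 (v x) W0 u1.
have k0 : 0 <= w' x - w x by rewrite subr_ge0; case/andP: (ww' x).
have ge1 : 1 <= 1 + (w' x - w x) * dot (v x *m invmx (gram v (W s))) (v x).
  by rewrite lerDl mulr_ge0.
rewrite e det_rank1 //; split.
  rewrite normrM (ger0_norm (le_trans ler01 ge1)).
  by apply: le_trans le1 _; rewrite ler_peMr.
rewrite unitmxE det_rank1 // unitrM -unitmxE u1 unitfE gt_eqF //.
exact: lt_le_trans ge1.
Qed.

Lemma gram_scale w (a : R) : gram v (fun x => a * w x) = a *: gram v w.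
Proof. by rewrite /gram scaler_sumr; apply: eq_bigr => x _; rewrite scalerA. Qed.

End Gram.

Lemma bernoulli (R : realFieldType) (t : R) n : -1 <= t -> 1 + n%:R * t <= (1 + t) ^+ n.
Proof.
move=> t1; elim: n => [|n IH]; first by rewrite mul0r addr0 expr0.
rewrite exprS; apply: le_trans (ler_wpM2l _ IH); last by lra.
have := ler0n R n; rewrite -natr1; nra.
Qed.

(** With [h = 1/(2q)], Bernoulli gives [(1 - h)^q >= 1/2], hence [(1 + h)^q <= 2]. If [t < u h],
    then [(1 + t)^q < (1 + h)^(q u) <= 2^u]. *)
Lemma le_of_pow2_le (R : realFieldType) (q u : nat) (t : R) : (0 < q)%N -> 0 <= t ->
  2 ^+ u <= (1 + t) ^+ q -> u%:R <= 2 * q%:R * t.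
Proof.
move=> q0 t0; have q0R : 0 < q%:R :> R by rewrite ltr0n.
apply: contraTT; rewrite -!ltNge => tu.
pose h : R := (2 * q%:R)^-1.
have h0 : 0 < h by rewrite invr_gt0; lra.
have hq : 2 * q%:R * h = 1 by rewrite divff //; apply: lt0r_neq0; lra.
have q1 : 1 <= q%:R :> R by rewrite ler1n.
have h1 : 2 * h <= 1 by nra.
have small : (1 + h) ^+ q <= 2.
  have bern : 1 - q%:R * h <= (1 - h) ^+ q.
    by rewrite -mulrN; apply: bernoulli; lra.
  have : (1 + h) ^+ q * (1 - h) ^+ q <= 1.
    rewrite -exprMn; apply: exprn_ile1; nra.
  have : 0 <= (1 + h) ^+ q by apply: exprn_ge0; lra.
  by nra.
have lt1 : (1 + t) ^+ q < (1 + u%:R * h) ^+ q.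
  rewrite ltrXn2r -?lt0n //; first by lra.
  have e : u%:R * h * (2 * q%:R) = u%:R by rewrite -mulrA [h * _]mulrC hq mulr1.
  suff : t < u%:R * h by lra.
  have : t * (2 * q%:R) < u%:R * h * (2 * q%:R) by rewrite e mulrC.
  by rewrite ltr_pM2r //; lra.
apply: lt_le_trans lt1 _.
have : (1 + u%:R * h) ^+ q <= ((1 + h) ^+ q) ^+ u.
  rewrite -exprM mulnC exprM; apply: lerXn2r; rewrite ?nnegrE.
  - by have := ler0n R u; nra.
  - by apply: exprn_ge0; lra.
  - by apply: bernoulli; lra.
move/le_trans; apply; apply: lerXn2r => //; rewrite nnegrE ?ler0n //.
by apply: exprn_ge0; lra.
Qed.

(* A one-sided form of radial isotropic position: outside B the leverage
   scores of the rescaled vectors are bounded below, and B does not span.  The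
   scales are powers of two minimising the determinant of the Gram matrix
   against a product of the scales. *)
Lemma leverage_scales (R : realType) (T : finType) (d : nat) (v : T -> 'rV[R]_d)
    (s : T -> nat) (S := (\sum_x s x)%N) :
  (0 < d)%N -> (0 < S)%N -> gram v (fun=> 1) \in unitmx ->
  exists (r : T -> R) (B : {set T}), let M := gram v (fun x => r x ^+ 2) in
  [/\ forall x, 0 < r x, M \in unitmx,
      forall x, x \notin B ->
        (d * s x)%:R <= (12 * S)%:R * (r x ^+ 2 * dot (v x *m invmx M) (v x)) &
      exists2 u, u != 0 & forall x, x \in B -> dot u (v x) = 0].
Proof.
move=> d0 S0 G1.
(* Exponent [2 S] for the determinant: scaling all weights by [4^L] gains [4^(2 d S L)] against the
   [4^(d S L)] of the denominator. This surplus keeps [B] from spanning. *)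
pose q := (2 * S)%N.
pose MB (B : {set T}) := gram v (fun x => (x \in B)%:R : R).
(* The cap [L] on the exponents dominates these ratios for all [B] at once, and makes the
   minimisation finite. *)
pose bnd (B : {set T}) := Num.bound (`|\det (gram v (fun=> 1))| ^+ q / `|\det (MB B)| ^+ q).
pose L := (\max_B bnd B)%N.
have [W WE] : {W : {ffun T -> 'I_L.+1} -> T -> R | forall k x, W k x = (2 ^+ k x) ^+ 2}.
  by exists (fun (k : {ffun T -> 'I_L.+1}) x => (2 ^+ k x) ^+ 2).
have W4 k x : W k x = 4 ^+ k x by rewrite WE -exprM mulnC exprM; congr (_ ^+ _); rewrite expr2 -natrM.
pose val (k : {ffun T -> 'I_L.+1}) : R := 
  `|\det (gram v (W k))| ^+ q / 4 ^+ (d * \sum_x s x * k x).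
pose k0 := [ffun x : T => ord0 : 'I_L.+1].
have [k _ kmin] := arg_minP val (isT : xpredT k0).
have Wunit : gram v (W k) \in unitmx /\ `|\det (gram v (fun=> 1))| <= `|\det (gram v (W k))|.
  have [] := @gram_mono _ _ _ v (fun=> 1) (W k) _ G1 => // x.
  by rewrite ler01 W4 exprn_ege1 // ler1n.
case: Wunit => Wunit Wdet.
have det0 : 0 < `|\det (gram v (W k))| by rewrite normr_gt0 -unitfE -unitmxE.
have gramE : gram v (fun x => (2 ^+ k x) ^+ 2) = gram v (W k).
  by apply: eq_bigr => x _; rewrite WE.
exists (fun x => 2 ^+ k x), [set x | (k x == L :> nat)]; rewrite gramE; split => //.
- by move=> x; rewrite exprn_gt0.
- move=> x; rewrite inE => kxL.
  have kxlt : (k x < L)%N by have := ltn_ord (k x); rewrite ltnS leq_eqVlt (negbTE kxL).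
  (* Doubling the scale at [x] quadruples its weight: the determinant gains the factor [1 + 3 tau],
     so minimality gives [4^(d s x) <= (1 + 3 tau)^q]. *)
  pose k' := [ffun y => if y == x then inord (k x).+1 else k y] : {ffun T -> 'I_L.+1}.
  have k'x : k' x = (k x).+1 :> nat by rewrite ffunE eqxx inordK.
  have k'y y : y != x -> k' y = k y by rewrite ffunE => /negbTE->.
  have := kmin k' isT; rewrite /val.
  have -> : gram v (W k') = gram v (W k) + (3 * W k x) *: ((v x)^T *m v x).
    rewrite -gram_set; apply: eq_bigr => y _; congr (_ *: _).
    case: eqVneq => [->|yx]; last by rewrite !W4 k'y.
    by rewrite !W4 k'x exprS; move: (4 ^+ k x) => a; ring.
  rewrite det_rank1 // -[3 * W k x * _]mulrA -WE.
  set tau := W k x * _.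
  have tau0 : 0 <= tau.
    rewrite mulr_ge0 //; first by rewrite W4 exprn_ge0.
    by apply: dot_inv_ge0 => // y; rewrite W4 exprn_ge0.
  have -> : (\sum_x s x * k' x = \sum_x s x * k x + s x)%N.
    rewrite (bigD1 x) //= [in RHS](bigD1 x) //= k'x mulnS -addnA addnC; congr (_ + _ + _)%N.
    by apply: eq_bigr => y yx; rewrite k'y.
  rewrite mulnDr exprD normrM exprMn.
  set D := `|_| ^+ q; set N := 4 ^+ _; set N' := 4 ^+ _.
  have D0 : 0 < D by rewrite exprn_gt0.
  have N0 : 0 < N by rewrite exprn_gt0.
  have N'0 : 0 < N' by rewrite exprn_gt0.
  rewrite [`|_ + _|]ger0_norm; last by lra.
  rewrite ler_pdivrMr //.
  have -> : D * (1 + 3 * tau) ^+ q / (N * N') * N = D * ((1 + 3 * tau) ^+ q / N').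
    by field; rewrite !gt_eqF.
  rewrite ler_pMr // ler_pdivlMr // mul1r => H.
  have tau3 : 0 <= 3 * tau by lra.
  have q0 : (0 < q)%N by rewrite muln_gt0.
  have := @le_of_pow2_le R q (d * s x) (3 * tau) q0 tau3.
  have le24 : 2 ^+ (d * s x) <= N' by apply: lerXn2r; rewrite ?nnegrE //; lra.
  move=> /(_ (le_trans le24 H)) /le_trans; apply.
  by rewrite /q !natrM; lra.
- set B := [set x | _].
  (* If the vectors of [B] spanned, the weights [4^L] on [B] would make the determinant too large
     for a minimiser, by comparison with all exponents zero. *)
  have [MBu|/gram_singular H] := boolP (MB B \in unitmx); last first.
    have [] := H; first by move=> x; rewrite ler0n.
    by move=> u u0 Hu; exists u => // x xB; apply: Hu; rewrite xB.
  have MB0 : 0 < `|\det (MB B)| by rewrite normr_gt0 -unitfE -unitmxE.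
  have big : `|\det (gram v (fun=> 1))| ^+ q < L%:R * `|\det (MB B)| ^+ q.
    rewrite -ltr_pdivrMr ?exprn_gt0 //.
    have : (bnd B)%:R <= L%:R :> R by rewrite ler_nat; apply: leq_bigmax.
    apply: lt_le_trans; apply: archi_boundP.
    by rewrite divr_ge0 ?exprn_ge0.
  have lower : 4 ^+ (L * d) * `|\det (MB B)| <= `|\det (gram v (W k))|.
    have [x||+ _] := @gram_mono _ _ _ v (fun x => 4 ^+ L * (x \in B)%:R) (W k).
    - rewrite inE W4; case: eqP => [->|_]; rewrite ?mulr1 ?mulr0 ?exprn_ge0 ?lexx //.
    - by rewrite gram_scale unitmxZ ?unitfE ?expf_neq0 ?pnatr_eq0.
    - by rewrite gram_scale -/(MB B) detZ normrM -exprM ger0_norm ?exprn_ge0.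
  have upper : `|\det (gram v (W k))| ^+ q <= `|\det (gram v (fun=> 1))| ^+ q * 4 ^+ (d * (S * L)).
    have := kmin k0 isT; rewrite /val.
    have -> : gram v (W k0) = gram v (fun=> 1) by apply: eq_bigr => x _; rewrite W4 ffunE expr0.
    have -> : (\sum_x s x * k0 x = 0)%N by apply: big1 => x _; rewrite /k0 ffunE muln0.
    rewrite muln0 expr0 divr1.
    rewrite ler_pdivrMr ?exprn_gt0 // => /le_trans; apply.
    apply: ler_wpM2l; first exact: exprn_ge0.
    rewrite ler_eXn2l ?ltr1n // leq_mul2l big_distrl /=; apply/orP; right.
    by apply: leq_sum => x _; rewrite leq_mul2l -ltnS ltn_ord orbT.
  have lowq : 4 ^+ (L * d * q) * `|\det (MB B)| ^+ q <= `|\det (gram v (W k))| ^+ q.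
    rewrite exprM -exprMn; apply: lerXn2r => //; rewrite nnegrE ?mulr_ge0 ?exprn_ge0 //.
  have L4 : L%:R <= 4 ^+ (d * (S * L)) :> R.
    rewrite -natrX ler_nat; apply: leq_trans (ltnW (ltn_expl L (isT : 1 < 4)%N)) _.
    by rewrite leq_exp2l // mulnA leq_pmull // muln_gt0 d0.
  have := le_trans lowq upper.
  have -> : (L * d * q = d * (S * L) + d * (S * L))%N by rewrite /q; ring.
  rewrite exprD mulrAC -subr_ge0 -mulrBl pmulr_lge0 ?exprn_gt0 // subr_ge0 => H.
  have := lt_le_trans big (ler_wpM2r (exprn_ge0 _ (normr_ge0 _)) L4).
  by rewrite ltNge H.
Qed.

(** * Random signs *)

(* Average of F over the 2^(size ps) vectors u + sum of +-p, p in ps. *)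
Fixpoint sign_avg (R : fieldType) (d : nat) (ps : seq 'rV[R]_d) (F : 'rV[R]_d -> R)
    (u : 'rV[R]_d) : R :=
  if ps is p :: ps' then (sign_avg ps' F (u + p) + sign_avg ps' F (u - p)) / 2
  else F u.

Section SignAverage.
Variables (R : realFieldType) (d : nat).
Implicit Types (ps : seq 'rV[R]_d) (F G : 'rV[R]_d -> R) (u c : 'rV[R]_d).

Lemma eq_sign_avg ps F G u : F =1 G -> sign_avg ps F u = sign_avg ps G u.
Proof. by move=> FG; elim: ps u => //= p ps IH u; rewrite !IH. Qed.

Lemma sign_avgD ps F G u :
  sign_avg ps (fun x => F x + G x) u = sign_avg ps F u + sign_avg ps G u.
Proof. by elim: ps u => //= p ps IH u; rewrite !IH; lra. Qed.

Lemma sign_avgZ ps a F u : sign_avg ps (fun x => a * F x) u = a * sign_avg ps F u.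
Proof. by elim: ps u => //= p ps IH u; rewrite !IH; lra. Qed.

Lemma sign_avg_cst ps a u : sign_avg ps (fun=> a) u = a.
Proof. by elim: ps u => //= p ps IH u; rewrite !IH; lra. Qed.

Lemma sign_avg_sum (I : Type) (r : seq I) (P : pred I) (F : I -> 'rV[R]_d -> R) ps u :
  sign_avg ps (fun x => \sum_(i <- r | P i) F i x) u = \sum_(i <- r | P i) sign_avg ps (F i) u.
Proof.
elim: r => [|i r IH].
  by rewrite big_nil -[RHS](sign_avg_cst ps 0 u); apply: eq_sign_avg => x; rewrite big_nil.
rewrite big_cons -IH; case Pi: (P i); last first.
  by apply: eq_sign_avg => x; rewrite big_cons Pi.
by rewrite -sign_avgD; apply: eq_sign_avg => x; rewrite big_cons Pi.
Qed.

Lemma sign_avg_attained ps F u : exists u', sign_avg ps F u <= F u'.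
Proof.
elim: ps u => [|p ps IH] u /=; first by exists u.
have [a Ha] := IH (u + p); have [b Hb] := IH (u - p).
by case: (lerP (F a) (F b)) => ab; [exists b | exists a]; lra.
Qed.

Lemma sign_avg_sqr ps c u :
  sign_avg ps (fun x => dot x c ^+ 2) u = dot u c ^+ 2 + \sum_(p <- ps) dot p c ^+ 2.
Proof.
elim: ps u => [|p ps IH] u /=; first by rewrite big_nil addr0.
by rewrite !IH big_cons !dotDl dotNl; field.
Qed.

(** A general starting point [u] carries the induction; adding [p] leaves a slack of
    [2 (dot p c)^4]. At [u = 0] the fourth moment is at most three times the squared variance. *)
Lemma sign_avg_quartic ps c u (A := \sum_(p <- ps) dot p c ^+ 2) :
  sign_avg ps (fun x => dot x c ^+ 4) u <= dot u c ^+ 4 + 6 * dot u c ^+ 2 * A + 3 * A ^+ 2.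
Proof.
rewrite /A {A}; elim: ps u => [|p ps IH] u /=; first by rewrite big_nil; lra.
move: (IH (u + p)) (IH (u - p)); rewrite big_cons !dotDl dotNl.
set A := \sum_(_ <- _) _; have A0 : 0 <= A by apply: sumr_ge0 => i _; apply: sqr_ge0.
move: (dot u c) (dot p c) => x a.
move: (sign_avg _ _ _) (sign_avg _ _ _) => g f Hf Hg.
have : (f + g) / 2 <= x ^+ 4 + 6 * x ^+ 2 * a ^+ 2 + a ^+ 4 + 6 * (x ^+ 2 + a ^+ 2) * A + 3 * A ^+ 2.
  rewrite ler_pdivrMr ?ltr0n //; apply: le_trans (lerD Hf Hg) _.
  by rewrite le_eqVlt; apply/orP; left; apply/eqP; ring.
move/le_trans; apply; rewrite -subr_ge0.
have -> : x ^+ 4 + 6 * x ^+ 2 * (a ^+ 2 + A) + 3 * (a ^+ 2 + A) ^+ 2 -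
  (x ^+ 4 + 6 * x ^+ 2 * a ^+ 2 + a ^+ 4 + 6 * (x ^+ 2 + a ^+ 2) * A + 3 * A ^+ 2) =
  2 * (a ^+ 2) ^+ 2 by ring.
by rewrite mulr_ge0 ?sqr_ge0.
Qed.

End SignAverage.

(** * Leverage scores and correlations inside a class *)

Lemma dot_mul_sym (R : comPzRingType) (d : nat) (S : 'M[R]_d) (u v : 'rV[R]_d) :
  S^T = S -> dot (u *m S) v = dot u (v *m S).
Proof. by move=> sS; rewrite /dot trmx_mul sS mulmxA. Qed.

Lemma mxtrace_dot (R : comPzRingType) (d : nat) (S : 'M[R]_d) (v : 'rV[R]_d) :
  dot (v *m S) v = \tr (S *m (v^T *m v)).
Proof. by rewrite mulmxA mxtrace_mulC mulmxA trace_mx11. Qed.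

Section Leverage.
Variables (R : realFieldType) (T : finType) (d : nat) (v : T -> 'rV[R]_d) (r : T -> R).
Let M := gram v (fun x => r x ^+ 2).
Hypothesis Mu : M \in unitmx.
Let nrm (c c' : 'rV[R]_d) := dot (c *m invmx M) c'.

Lemma invmx_gram_sym : (invmx M)^T = invmx M.
Proof. by rewrite trmx_inv gram_sym. Qed.

(** Since [M^-1 M M^-1 = M^-1], a random sign sum of the vectors [r x *: (v x *m invmx M)] has
    covariance form [nrm]. *)
Lemma dot_invmx_sum c c' :
  \sum_x dot (r x *: (v x *m invmx M)) c * dot (r x *: (v x *m invmx M)) c' = nrm c c'.
Proof.
rewrite /nrm -{2}[c'](mulmxKV Mu) -(dot_mul_sym _ _ (gram_sym _ _)) dot_gram.
apply: eq_bigr => x _; rewrite !dotZl [dot _ (v x)]dotC.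
by rewrite !(dot_mul_sym _ _ invmx_gram_sym); ring.
Qed.

Lemma leverage_sum : \sum_x r x ^+ 2 * nrm (v x) (v x) = d%:R.
Proof.
rewrite -(mxtrace1 R d) -(mulVmx Mu) /M /gram mulmx_sumr raddf_sum /=.
by apply: eq_bigr => x _; rewrite -scalemxAr mxtraceZ /nrm mxtrace_dot.
Qed.

(** The matrix with entries [r y * r z * nrm (v y) (v z)] is a symmetric projection, so its square
    has the same diagonal. *)
Lemma leverage_row y :
  \sum_z (r y * r z * nrm (v y) (v z)) ^+ 2 = r y ^+ 2 * nrm (v y) (v y).
Proof.
rewrite -(dot_invmx_sum (v y) (v y)) mulr_sumr; apply: eq_bigr => z _.
by rewrite !dotZl !(dot_mul_sym _ _ invmx_gram_sym) /nrm dotC; ring.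
Qed.

End Leverage.

Section Separation.
Variables (R : realType) (T : finType) (d : nat) (v : T -> 'rV[R]_d) (e : rel T).
Hypotheses (esym : symmetric e) (etr : transitive e).
Let s (x : T) := #|e x|.

(** The relation [e] is a partial equivalence: a point related to nothing has [s x = 0], which will
    be the case of points on a zero set. *)
Lemma per_card x y : e x y -> s x = s y.
Proof.
move=> exy; have eyx : e y x by rewrite esym.
by apply: eq_card => z; apply/idP/idP; [exact: etr eyx | exact: etr exy].
Qed.

Lemma per_card_gt0 x y : e x y -> (0 < s x)%N.
Proof. by move=> exy; apply/card_gt0P; exists y. Qed.

Lemma per_refl x y : e x y -> e y y.
Proof. by move=> exy; have exy' := exy; rewrite esym in exy'; exact: etr exy' exy. Qed.

Lemma sum_inv_card y : \sum_(x | e x y) (s x)%:R^-1 <= 1 :> R.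
Proof.
rewrite (eq_bigr (fun=> (s y)%:R^-1)); last by move=> x /per_card ->.
rewrite sumr_const.
have -> : #|[pred x | e x y]| = s y by apply: eq_card => x; rewrite !inE esym.
have [->|s0] := posnP (s y); first by rewrite mulr0n.
by rewrite -[leLHS]mulr_natl divff // pnatr_eq0 -lt0n.
Qed.

Section Norm.
Variable (r : T -> R).
Let M := gram v (fun x => r x ^+ 2).
Hypothesis Mu : M \in unitmx.
Let tau x := r x ^+ 2 * dot (v x *m invmx M) (v x).
Let c x := (r x / Num.sqrt (tau x)) *: v x.

Lemma norm_unit_vector x : 0 < tau x -> dot (c x *m invmx M) (c x) = 1.
Proof.
move=> t0; rewrite /c -scalemxAl dotZl dotZr.
have : Num.sqrt (tau x) ^+ 2 = tau x by rewrite sqr_sqrtr // ltW.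
have : Num.sqrt (tau x) != 0 by rewrite gt_eqF // sqrtr_gt0.
move: (Num.sqrt _) => q q0 Hq.
suff -> : r x / q * (r x / q * dot (v x *m invmx M) (v x)) = tau x / q ^+ 2.
  by rewrite Hq divff // gt_eqF.
by rewrite /tau; field.
Qed.

(* By AM-GM the correlation of two unit vectors of one class is at most
   (beta/2 + P^2/(2 beta)) / (k s x), and the squared entries of the projection
   P sum to d. *)
Lemma sum_norm_le (B : {set T}) (k b : R) : 0 < k -> 0 < b ->
  (forall x, x \notin B -> k * (s x)%:R <= tau x) ->
  \sum_x dot ((\sum_(y | e x y && (y \notin B)) c y) *m invmx M)
             (\sum_(y | e x y && (y \notin B)) c y)
  <= k^-1 * (b / 2 * (\sum_x (s x)%:R) + d%:R / (2 * b)).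
Proof.
move=> k0 b0 Hk.
pose P y z := r y * r z * dot (v y *m invmx M) (v z).
have cc x y z : e x y -> e x z -> y \notin B -> z \notin B ->
    dot (c y *m invmx M) (c z) <= k^-1 * (s x)%:R^-1 * (b / 2 + P y z ^+ 2 / (2 * b)).
  move=> exy exz yB zB.
  have sx0 : 0 < (s x)%:R :> R by rewrite ltr0n (per_card_gt0 exy).
  have ty : k * (s x)%:R <= tau y by rewrite (per_card exy); apply: Hk.
  have tz : k * (s x)%:R <= tau z by rewrite (per_card exz); apply: Hk.
  have ks0 : 0 < k * (s x)%:R by rewrite mulr_gt0.
  have h0 := ltW ks0.
  have sq y' : k * (s x)%:R <= tau y' -> Num.sqrt (k * (s x)%:R) <= Num.sqrt (tau y').
    by move=> ?; apply: ler_wsqrtr.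
  rewrite /c -scalemxAl dotZl dotZr.
  have := sqr_sqrtr h0; have := sq _ ty; have := sq _ tz.
  have : 0 < Num.sqrt (k * (s x)%:R) by rewrite sqrtr_gt0.
  set p := Num.sqrt (k * _); set p1 := Num.sqrt (tau y); set p2 := Num.sqrt (tau z).
  move=> p0 p2p p1p pp.
  have -> : r y / p1 * (r z / p2 * dot (v y *m invmx M) (v z)) = P y z / (p1 * p2).
    by rewrite /P; field; rewrite !gt_eqF //; lra.
  have -> : k^-1 * (s x)%:R^-1 = (p ^+ 2)^-1 by rewrite pp invfM.
  have p12 : p ^+ 2 <= p1 * p2 by rewrite expr2; apply: ler_pM => //; lra.
  have p120 : 0 < p1 * p2 by apply: lt_le_trans p12; rewrite exprn_gt0.
  apply: (@le_trans _ _ (`|P y z| / (p1 * p2))).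
    by rewrite ler_pM2r ?invr_gt0 // ler_norm.
  apply: (@le_trans _ _ (`|P y z| / p ^+ 2)).
    apply: ler_wpM2l => //; rewrite lef_pV2 ?posrE ?exprn_gt0 //.
  rewrite mulrC; apply: ler_wpM2l; first by rewrite invr_ge0 exprn_ge0 // ltW.
  rewrite -subr_ge0.
  have -> : b / 2 + P y z ^+ 2 / (2 * b) - `|P y z| = (b - `|P y z|) ^+ 2 / (2 * b).
    by rewrite -[P y z ^+ 2]real_normK ?num_real //; field; rewrite gt_eqF.
  by rewrite divr_ge0 ?sqr_ge0 //; lra.
have P2 y : \sum_z P y z ^+ 2 = tau y by rewrite /P (leverage_row Mu).
apply: (@le_trans _ _ (\sum_x \sum_(y | e x y) \sum_(z | e x z)
    k^-1 * (s x)%:R^-1 * (b / 2 + P y z ^+ 2 / (2 * b)))).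
  apply: ler_sum => x _; rewrite mulmx_suml dot_suml.
  rewrite big_mkcondr /=; apply: ler_sum => y exy.
  have pos z : 0 <= k^-1 * (s x)%:R^-1 * (b / 2 + P y z ^+ 2 / (2 * b)).
    apply: mulr_ge0; first by rewrite mulr_ge0 ?invr_ge0 ?ler0n // ltW.
    by rewrite addr_ge0 ?divr_ge0 ?sqr_ge0 //; lra.
  case: ifP => yB; last by apply: sumr_ge0.
  rewrite dot_sumr big_mkcondr /=; apply: ler_sum => z exz.
  by case: ifP => zB //; apply: cc.
have -> : \sum_x \sum_(y | e x y) \sum_(z | e x z)
    k^-1 * (s x)%:R^-1 * (b / 2 + P y z ^+ 2 / (2 * b)) =
    k^-1 * (b / 2 * (\sum_x \sum_(y | e x y) \sum_(z | e x z) (s x)%:R^-1)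
     + (2 * b)^-1 * \sum_x \sum_(y | e x y) \sum_(z | e x z) (s x)%:R^-1 * P y z ^+ 2).
  rewrite !(mulr_sumr, =^~ big_split) /=; apply: eq_bigr => x _.
  rewrite !(mulr_sumr, =^~ big_split) /=; apply: eq_bigr => y _.
  rewrite !(mulr_sumr, =^~ big_split) /=; apply: eq_bigr => z _.
  by move: (s x)%:R^-1 => q; field; rewrite !gt_eqF.
apply: ler_wpM2l; first by rewrite invr_ge0 ltW.
rewrite [d%:R / _]mulrC; apply: lerD.
  apply: ler_wpM2l; first by rewrite divr_ge0 // ltW.
  apply: ler_sum => x _; rewrite !sumr_const.
  have -> : #|[pred z | e x z]| = s x by apply: eq_card.
  have [->|s0] := posnP (s x); first by rewrite mulr0n.
  by rewrite -mulrnA -[leLHS]mulr_natl natrM mulfK // pnatr_eq0 -lt0n.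
apply: ler_wpM2l; first by rewrite invr_ge0 mulr_ge0 // ltW.
(* After exchanging sums, the weights [1 / s x] over the class of [y] add up to at most 1; what
   remains is the sum of the leverage scores, which is [d]. *)
rewrite -(leverage_sum Mu) (exchange_big_dep xpredT) //=; apply: ler_sum => y _.
rewrite -/(tau y) -(P2 y).
apply: (@le_trans _ _ (\sum_(x | e x y) (s x)%:R^-1 * \sum_z P y z ^+ 2)).
  apply: ler_sum => x _; rewrite -mulr_sumr; apply: ler_wpM2l; first by rewrite invr_ge0 ler0n.
  by rewrite [leRHS](bigID (e x)) /= lerDl; apply: sumr_ge0 => *; apply: sqr_ge0.
rewrite -mulr_suml; apply: ler_piMl (sum_inv_card y).
by apply: sumr_ge0 => *; apply: sqr_ge0.
Qed.

End Norm.
End Separation.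

(** * A vector whose sign separates many pairs *)

Section SeparatingVector.
Variables (R : realType) (T : finType) (d : nat) (v : T -> 'rV[R]_d) (e : rel T).
Hypotheses (esym : symmetric e) (etr : transitive e).
Let s (x : T) : nat := #|e x|.
Let sR (x : T) : R := (s x)%:R.
Let sep (u : 'rV[R]_d) (x y : T) := e x y && ~~ (0 < dot u (v x) * dot u (v y)).
(** With the weight [s x], this bounds from below the drop in the sum of squared class sizes when
    classes are split by the sign of [u]. *)
Let loss u : R := \sum_x sR x * #|sep u x|%:R.

Lemma loss_vanish u (P : pred T) : (forall x, P x -> dot u (v x) = 0) ->
  \sum_(x | P x) sR x ^+ 2 <= loss u.
Proof.
move=> Pu; rewrite /loss [leRHS](bigID P) /= -[leLHS]addr0; apply: lerD; last first.
  by apply: sumr_ge0 => x _; rewrite mulr_ge0 ?ler0n.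
apply: ler_sum => x Px; rewrite expr2; apply: ler_wpM2l; first exact: ler0n.
rewrite ler_nat; apply: subset_leq_card; apply/subsetP => y; rewrite !unfold_in => exy.
by rewrite /sep exy Pu // mul0r ltxx.
Qed.

(** With [sg] the sign of [u] at [x], the last absolute value is at least [sg] times the sum. A
    point [y] on the same side then contributes [- h^2 / 8], a separated one at most
    [2 |h| - h^2 / 8 <= 8]. *)
Lemma loss_lower u (a : T -> R) (B : {set T}) (h := fun y => a y * dot u (v y)) :
  (forall x, 0 <= a x) ->
  \sum_x sR x * (\sum_(y | e x y && (y \notin B)) (`|h y| - 8^-1 * h y ^+ 2)
                - `|\sum_(y | e x y && (y \notin B)) h y|) <= 8 * loss u.
Proof.
move=> a0; rewrite /loss mulr_sumr; apply: ler_sum => x _.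
rewrite mulrCA; apply: ler_wpM2l; first exact: ler0n.
pose sg : R := if 0 < dot u (v x) then 1 else -1.
set H := \sum_(_ | _) h _.
have sgH : sg * H <= `|H|.
  by rewrite /sg; case: ifP => _; rewrite ?mul1r ?mulN1r ?ler_norm // -normrN ler_norm.
apply: (@le_trans _ _ (\sum_(y | e x y && (y \notin B)) (`|h y| - 8^-1 * h y ^+ 2 - sg * h y))).
  by rewrite [leRHS]sumrB -mulr_sumr -/H; lra.
have -> : 8 * #|sep u x|%:R = \sum_(y | e x y) (sep u x y)%:R * 8 :> R.
  rewrite -mulr_suml mulrC; congr (_ * _).
  rewrite -sum1_card natr_sum big_mkcond /= [RHS]big_mkcond; apply: eq_bigr => y _.
  by rewrite unfold_in /sep; case: (e x y) => //=; case: ifP.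
rewrite big_mkcondr; apply: ler_sum => y exy; case: ifP => _; last first.
  by rewrite mulr_ge0 ?ler0n.
rewrite /sep exy /=.
have hb : `|h y| - 8^-1 * h y ^+ 2 - sg * h y <= 8.
  have : - sg * h y <= `|h y|.
    by rewrite /sg; case: ifP => _; rewrite ?opprK ?mul1r ?mulN1r ?ler_norm // -normrN ler_norm.
  have : h y ^+ 2 = `|h y| ^+ 2 by rewrite real_normK ?num_real.
  have : 0 <= (`|h y| - 8) ^+ 2 by apply: sqr_ge0.
  rewrite mulNr; move: (h y ^+ 2) (sg * h y) (`|h y|) => q w t; nra.
have [xy|_] /= := boolP (0 < _); last by rewrite mul1r.
rewrite mul0r.
suff -> : `|h y| = sg * h y by have := sqr_ge0 (h y); lra.
rewrite /h /sg; case: (ltP 0 (dot u (v x))) xy => x0 xy.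
  have y0 : 0 < dot u (v y) by rewrite -(pmulr_rgt0 _ x0).
  by rewrite mul1r ger0_norm // mulr_ge0 // ltW.
have y0 : dot u (v y) < 0.
  have xn : dot u (v x) < 0 by rewrite lt_neqAle x0 andbT; apply: contraTneq xy => ->; rewrite mul0r ltxx.
  by rewrite -(nmulr_rgt0 _ xn).
by rewrite mulN1r ler0_norm // mulr_ge0_le0 // ltW.
Qed.

(* A random f, of unit variance at every point outside B and with nearly
   uncorrelated values there, has Psi := sum_x s x (sum_y (|h y| - h y^2/8) -
   |sum_y h y|) of average at least E3/64, because |h| >= h^2 - h^4/4 and the
   fourth moments are at most 3; while Psi is bounded by the separated pairs. *)
Lemma separating_vector :
  (0 < d)%N -> (0 < \sum_x s x ^ 2)%N ->
  2 ^+ 26 * (\sum_x sR x) ^+ 3 <= d%:R * (\sum_x sR x ^+ 2) ^+ 2 ->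
  exists2 u, u != 0 & \sum_x sR x ^+ 2 <= 512 * loss u.
Proof.
move=> d0 E30 dlarge; set E3 := \sum_x sR x ^+ 2.
have loss0 u : 0 <= loss u by apply: sumr_ge0 => x _; rewrite mulr_ge0 ?ler0n.
have E2pos : (0 < \sum_x s x)%N.
  move: E30; rewrite !lt0n; apply: contraNneq => /eqP.
  by rewrite sum_nat_eq0 => /forallP S0; rewrite big1 // => x _; rewrite (eqP (S0 x)).
have E3R0 : 0 < E3.
  by rewrite /E3 (eq_bigr (fun x => (s x ^ 2)%:R)) -?natr_sum ?ltr0n // => x _; rewrite natrX.
have E2R0 : 0 < \sum_x sR x by rewrite -natr_sum ltr0n.
have [G1|] := boolP (gram v (fun=> 1) \in unitmx); last first.
  case/gram_singular => [x|u u0 Hu]; first exact: ler01.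
  exists u => //; have := @loss_vanish u xpredT (fun x _ => Hu x ltr01).
  by have := loss0 u; rewrite -/E3; lra.
have [r [B [r0 Mu Hlev [uB uB0 HuB]]]] := leverage_scales d0 E2pos G1.
set M := gram v _ in Mu Hlev.
(* If [B] carries half of [E3], the vector [uB] vanishing on [B] already separates enough pairs. *)
have [bigB|smallB] := lerP (E3 / 2) (\sum_(x in B) sR x ^+ 2).
  by exists uB => //; have := loss_vanish HuB; have := loss0 uB; lra.
pose tau x := r x ^+ 2 * dot (v x *m invmx M) (v x).
pose a x := r x / Num.sqrt (tau x).
have tau0 x : 0 <= tau x.
  by rewrite mulr_ge0 ?sqr_ge0 //; apply: dot_inv_ge0 => // y; apply: sqr_ge0.
have a0 x : 0 <= a x by rewrite divr_ge0 ?sqrtr_ge0 // ltW.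
pose c x := a x *: v x.
pose k : R := d%:R / (12 * \sum_x sR x).
have dR0 : 0 < d%:R :> R by rewrite ltr0n.
have k0 : 0 < k by rewrite divr_gt0 // mulr_gt0.
have Hk x : x \notin B -> k * sR x <= tau x.
  move=> /Hlev; rewrite !natrM natr_sum -/(sR x) -/(tau x) => H.
  by rewrite /k mulrAC ler_pdivrMr ?mulr_gt0 // [leRHS]mulrC.
pose Hx x := \sum_(y | e x y && (y \notin B)) c y.
(* This [b] makes the second term of [sum_norm_le] equal to [6 E3 / 2^13]; the dimension hypothesis
   bounds the first by the same amount. *)
pose b := 2 ^+ 13 * (\sum_x sR x) / E3.
have b0 : 0 < b by rewrite divr_gt0 // mulr_gt0 ?exprn_gt0.
have sumN : \sum_x dot (Hx x *m invmx M) (Hx x) <= E3 / 512.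
  apply: le_trans (sum_norm_le esym etr Mu k0 b0 Hk) _.
  move: dlarge; rewrite /k /b -/E3; set E2 := \sum_x _ => dl.
  have -> : (d%:R / (12 * E2))^-1 * (2 ^+ 13 * E2 / E3 / 2 * E2 + d%:R / (2 * (2 ^+ 13 * E2 / E3)))
     = 6 * 2 ^+ 13 * (E2 ^+ 3 / (E3 * d%:R)) + 6 / 2 ^+ 13 * E3.
    by field; rewrite !gt_eqF.
  have : E2 ^+ 3 / (E3 * d%:R) <= E3 / 2 ^+ 26.
    rewrite ler_pdivrMr ?mulr_gt0 // mulrAC ler_pdivlMr ?exprn_gt0 //.
    by rewrite mulrC; apply: le_trans dl _; rewrite expr2; lra.
  by move: (E2 ^+ 3 / _) => q; lra.
pose ps := [seq r x *: (v x *m invmx M) | x <- enum T].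
have ps2 w : \sum_(p <- ps) dot p w ^+ 2 = dot (w *m invmx M) w.
  rewrite big_map big_enum -(dot_invmx_sum Mu); apply: eq_bigr => x _.
  by rewrite expr2.
have N1 x y : e x y -> y \notin B -> dot (c y *m invmx M) (c y) = 1.
  move=> exy yB; apply: norm_unit_vector => //; apply: lt_le_trans (Hk _ yB).
  by rewrite mulr_gt0 // ltr0n; apply: per_card_gt0 (per_refl esym etr exy).
(* A quartic minorant of [8 * loss u], using also [s |H| <= s^2/32 + 8 H^2], so that only second and
   fourth moments have to be averaged. *)
pose lower (u : 'rV[R]_d) : R :=
  \sum_x sR x * (\sum_(y | e x y && (y \notin B)) (7 / 8 * dot u (c y) ^+ 2 + - 4^-1 * dot u (c y) ^+ 4))
  + (- E3 / 32 + - 8 * \sum_x dot u (Hx x) ^+ 2).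
have lowerE u : lower u <= 8 * loss u.
  apply: le_trans (loss_lower u B a0); rewrite /lower.
  have -> : - E3 / 32 + - 8 * (\sum_x dot u (Hx x) ^+ 2) =
      \sum_x (- (sR x ^+ 2 / 32) + - 8 * dot u (Hx x) ^+ 2).
    by rewrite big_split /= sumrN -mulr_suml mulr_sumr mulNr.
  rewrite -big_split /=; apply: ler_sum => x _.
  have -> : \sum_(y | e x y && (y \notin B)) a y * dot u (v y) = dot u (Hx x).
    by rewrite /Hx dot_sumr; apply: eq_bigr => y _; rewrite dotZr.
  have lo : \sum_(y | e x y && (y \notin B)) (7 / 8 * dot u (c y) ^+ 2 + - 4^-1 * dot u (c y) ^+ 4)
     <= \sum_(y | e x y && (y \notin B)) (`|a y * dot u (v y)| - 8^-1 * (a y * dot u (v y)) ^+ 2).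
    apply: ler_sum => y _; rewrite -dotZr -/(c y).
    have := real_normK (num_real (dot u (c y))); have := normr_ge0 (dot u (c y)).
    rewrite (exprM _ 2 2); move: `|_| => t t0 <-.
    have : 0 <= t * (1 - t + t ^+ 3 / 4).
      apply: mulr_ge0 => //.
      (* The cube lies above its tangent line at 6/5, which yields [1 - t + t^3/4 >= 0]. *)
      have : 0 <= (t - 6 / 5) ^+ 2 * (t + 12 / 5).
        by apply: mulr_ge0; [apply: sqr_ge0 | lra].
      have -> : (t - 6 / 5) ^+ 2 * (t + 12 / 5) = t ^+ 3 - 108 / 25 * t + 432 / 125 by field.
      by lra.
    by rewrite -exprM; lra.
  have := ler_wpM2l (ler0n R (s x)) lo; rewrite -/(sR x).
  rewrite mulrBr; move: (sR x * _) (sR x * _) => p q pq.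
  have : sR x * `|dot u (Hx x)| <= sR x ^+ 2 / 32 + 8 * dot u (Hx x) ^+ 2.
    rewrite -(real_normK (num_real (dot u (Hx x)))); move: `|_| (sR x) => t w.
    by have := sqr_ge0 (w / 16 - t); nra.
  by lra.
have [u Hu] := sign_avg_attained ps lower 0.
(* Each pair with [y] outside [B] gives at least [7/8 - 3/4 = 1/8], in all more than [E3/16];
   subtracting [E3/32] and [8 * E3/512] leaves [E3/64]. *)
have avg : E3 / 64 <= sign_avg ps lower 0.
  rewrite sign_avgD sign_avg_sum sign_avgD sign_avg_cst sign_avgZ sign_avg_sum.
  have -> : \sum_x sign_avg ps (fun u => dot u (Hx x) ^+ 2) 0 = \sum_x dot (Hx x *m invmx M) (Hx x).
    by apply: eq_bigr => x _; rewrite sign_avg_sqr dot0l expr0n add0r ps2.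
  have : \sum_x sR x * \sum_(y | e x y && (y \notin B)) 8^-1 <=
     \sum_x sign_avg ps (fun u => sR x *
        \sum_(y | e x y && (y \notin B)) (7 / 8 * dot u (c y) ^+ 2 + - 4^-1 * dot u (c y) ^+ 4)) 0.
    apply: ler_sum => x _; rewrite sign_avgZ; apply: ler_wpM2l; first exact: ler0n.
    rewrite sign_avg_sum; apply: ler_sum => y /andP[exy yB].
    rewrite sign_avgD !sign_avgZ sign_avg_sqr.
    have := sign_avg_quartic ps (c y) 0; rewrite ps2 (N1 x) // dot0l !expr0n /= expr1n.
    by lra.
  suff -> : \sum_x sR x * \sum_(y | e x y && (y \notin B)) 8^-1 = 8^-1 * \sum_(y | y \notin B) sR y ^+ 2.
    have : E3 = \sum_(y in B) sR y ^+ 2 + \sum_(y | y \notin B) sR y ^+ 2.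
      by rewrite /E3 (bigID (mem B)).
    by lra.
  rewrite mulr_sumr.
  under eq_bigr do rewrite mulr_sumr big_mkcondr /=.
  rewrite (exchange_big_dep xpredT) //= [RHS]big_mkcond; apply: eq_bigr => y _.
  case: ifP => _; last by rewrite big1.
  rewrite (eq_bigr (fun=> sR y / 8)); last by move=> x exy; rewrite /sR /s (per_card esym etr exy).
  rewrite sumr_const.
  have -> : #|[pred x | e x y]| = s y by apply: eq_card => x; rewrite !inE esym.
  by rewrite -[LHS]mulr_natr -/(sR y) expr2; field.
exists u; last by have := lowerE u; lra.
apply: contraTneq (le_trans avg Hu) => ->.
rewrite -ltNge /lower big1; last first.
  move=> x _; rewrite big1 ?mulr0 // => y _.
  by rewrite dot0l !expr0n !mulr0 addr0.
have : 0 <= \sum_x dot 0 (Hx x) ^+ 2 by apply: sumr_ge0 => *; apply: sqr_ge0.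
by lra.
Qed.

End SeparatingVector.

(** * Polynomial partitioning *)

Definition pt3 (R : Type) : Type := (R * R * R)%type.

(* Polynomials in three variables as lists of coefficients and exponents. *)
Definition pol3 (R : Type) : Type := seq (R * (nat * nat * nat)).

Definition mon3 (R : pzSemiRingType) (p : pt3 R) (a : nat * nat * nat) : R :=
  p.1.1 ^+ a.1.1 * p.1.2 ^+ a.1.2 * p.2 ^+ a.2.

Definition peval (R : pzSemiRingType) (f : pol3 R) (p : pt3 R) : R :=
  \sum_(t <- f) t.1 * mon3 p t.2.

Definition pdeg (R : Type) (f : pol3 R) : nat :=
  \max_(t <- f) (t.2.1.1 + t.2.1.2 + t.2.2).

(** Nonzero as a function: a list may repeat an exponent, and its coefficients may cancel. *)
Definition nonzero3 (R : pzSemiRingType) (f : pol3 R) : Prop := exists p, peval f p != 0.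

Section Monomials.
Variable R : realType.

Lemma poly0_of_horner0 (p : {poly R}) : (forall x, p.[x] = 0) -> p = 0.
Proof.
move=> pE; apply/eqP; apply: contraT => p0.
have := max_poly_roots p0 (rs := [seq n%:R | n <- iota 0 (size p)]).
rewrite size_map size_iota ltnn; apply.
  by apply/allP => x _; rewrite /root pE.
by rewrite map_inj_uniq ?iota_uniq // => m n /eqP; rewrite eqr_nat => /eqP.
Qed.

Lemma coef0_of_horner0 k (a : 'I_k -> R) :
  (forall x, \sum_(i < k) a i * x ^+ i = 0) -> forall i, a i = 0.
Proof.
move=> H.
have p0 : \sum_(i < k) a i *: 'X^i = 0 :> {poly R}.
  apply: poly0_of_horner0 => x; rewrite -[RHS](H x) horner_sum.
  by apply: eq_bigr => i _; rewrite hornerZ hornerXn.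
move=> i; have := congr1 (fun q : {poly R} => q`_i) p0; rewrite coef0 coef_sum (bigD1 i) //=.
rewrite coefZ coefXn eqxx mulr1 big1 ?addr0 // => j ji.
by rewrite coefZ coefXn eq_sym val_eqE (negbTE ji) mulr0.
Qed.

(** Bounding each exponent separately makes the dimension exactly [k^3], with total degrees below
    [3 k]. *)
Definition expo k : Type := ('I_k * 'I_k * 'I_k)%type.

Lemma coef0_of_eval0 k (a : expo k -> R) :
  (forall p : pt3 R, \sum_t a t * mon3 p (t.1.1 : nat, t.1.2 : nat, t.2 : nat) = 0) ->
  forall t, a t = 0.
Proof.
move=> H [[i j] l]; apply: (@coef0_of_horner0 k (fun l => a (i, j, l))) => z.
apply: (@coef0_of_horner0 k (fun j => \sum_l a (i, j, l) * z ^+ l)) => y.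
apply: (@coef0_of_horner0 k (fun i => \sum_(j : 'I_k) (\sum_(l : 'I_k) a (i, j, l) * z ^+ l) * y ^+ j)) => x.
pose g ij l := a (ij, l) * mon3 (x, y, z) (ij.1 : nat, ij.2 : nat, l : nat).
transitivity (\sum_t a t * mon3 (x, y, z) (t.1.1 : nat, t.1.2 : nat, t.2 : nat)) => //.
transitivity (\sum_ij \sum_l g ij l); last by rewrite pair_bigA; apply: eq_bigr => [[[? ?] ?]].
transitivity (\sum_i \sum_j \sum_l g (i, j) l); last by rewrite pair_bigA; apply: eq_bigr => [[? ?]].
apply: eq_bigr => i' _; rewrite mulr_suml; apply: eq_bigr => j' _.
by rewrite !mulr_suml; apply: eq_bigr => l' _; rewrite /g /mon3 /=; ring.
Qed.

Definition monomials k (p : pt3 R) : 'rV[R]_#|{: expo k}| :=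
  \row_i let t : expo k := enum_val i in mon3 p (t.1.1 : nat, t.1.2 : nat, t.2 : nat).

Definition pol_of_row k (u : 'rV[R]_#|{: expo k}|) : pol3 R :=
  [seq (u 0 (enum_rank t), (t.1.1 : nat, t.1.2 : nat, t.2 : nat)) | t : expo k <- enum {: expo k}].

Lemma peval_pol_of_row k u p : peval (@pol_of_row k u) p = dot u (monomials k p).
Proof.
rewrite /peval /pol_of_row big_map big_enum /dot mxE.
rewrite (reindex (fun i : 'I_#|{: expo k}| => enum_val i)) /=; last by apply: onW_bij; apply: enum_val_bij.
by apply: eq_bigr => i _; rewrite !mxE enum_valK.
Qed.

Lemma pdeg_pol_of_row k u : (pdeg (@pol_of_row k u) <= 3 * k)%N.
Proof.
rewrite /pdeg big_map; apply/bigmax_leqP_seq => t _ _ /=.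
move: (ltn_ord t.1.1) (ltn_ord t.1.2) (ltn_ord t.2).
by move: (nat_of_ord t.1.1) (nat_of_ord t.1.2) (nat_of_ord t.2) => a b c; lia.
Qed.

Lemma nonzero_pol_of_row k u : u != 0 -> nonzero3 (@pol_of_row k u).
Proof.
move=> u0; apply: contrapT => /forallNP H; case/negP: u0; apply/eqP/rowP => i; rewrite mxE.
rewrite -(enum_valK i); apply: (@coef0_of_eval0 k (fun t => u 0 (enum_rank t))) => p.
have /negP := H p; rewrite negbK => /eqP e0; rewrite -[RHS]e0.
by rewrite /peval /pol_of_row big_map big_enum.
Qed.

End Monomials.

(** The strict sign leaves points on a zero set in no cell, so the relation need not be
    reflexive. *)
Definition same_cell (R : numDomainType) (fs : seq (pol3 R)) : rel (pt3 R) :=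
  fun p q => all (fun f => 0 < peval f p * peval f q) fs.

Section Partition.
Variables (R : realType) (T : finType) (pts : T -> pt3 R).
Let cell (fs : seq (pol3 R)) : rel T := fun x y => same_cell fs (pts x) (pts y).
Let energy fs := (\sum_x #|cell fs x| ^ 2)%N.

Lemma cell_sym fs : symmetric (cell fs).
Proof. by move=> x y; rewrite /cell /same_cell; apply: eq_all => f; rewrite mulrC. Qed.

Lemma cell_trans fs : transitive (cell fs).
Proof.
move=> y x z /allP xy /allP yz; apply/allP => f ff.
have a := xy f ff; have b := yz f ff.
have y0 : peval f (pts y) != 0 by apply: contraTneq a => ->; rewrite mulr0 ltxx.
have : 0 < (peval f (pts x) * peval f (pts z)) * peval f (pts y) ^+ 2.
  have -> : (peval f (pts x) * peval f (pts z)) * peval f (pts y) ^+ 2 =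
     (peval f (pts x) * peval f (pts y)) * (peval f (pts y) * peval f (pts z)) by ring.
  exact: mulr_gt0.
by rewrite pmulr_lgt0 // exprn_even_gt0.
Qed.

(** Cauchy-Schwarz, [(sum s)^2 <= n * energy], turns the hypothesis into the dimension condition of
    [separating_vector] for [d = k^3]; a share 1/512 of the energy is then lost. *)
Lemma energy_step fs k : (0 < energy fs)%N -> (2 ^ 52 * #|T| ^ 3 <= k ^ 6 * energy fs)%N ->
  exists f, [/\ (pdeg f <= 3 * k)%N, nonzero3 f & (512 * energy (f :: fs) <= 511 * energy fs)%N].
Proof.
move=> E0 Hk.
have k0 : (0 < k)%N.
  rewrite lt0n; apply: contraTneq E0 => k0; move: Hk.
  rewrite k0 exp0n // mul0n leqn0 muln_eq0 !expn_eq0 /= andbT => /eqP /card0_eq T0.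
  by rewrite -leqNgt leqn0 /energy big1 // => x; have := T0 x; rewrite inE.
pose d := #|{: expo k}|.
have dE : d = (k ^ 3)%N by rewrite /d !card_prod card_ord; ring.
have d0 : (0 < d)%N by rewrite dE expn_gt0 k0.
pose v x := monomials k (pts x).
pose s x : R := #|cell fs x|%:R.
pose E2 := \sum_x s x; pose E3 := \sum_x s x ^+ 2.
have E3E : E3 = (energy fs)%:R by rewrite /energy natr_sum; apply: eq_bigr => x _; rewrite natrX.
have E20 : 0 <= E2 by apply: sumr_ge0 => x _; apply: ler0n.
have E30 : 0 < E3 by rewrite E3E ltr0n.
have E30' := ltW E30.
have cs : E2 ^+ 2 <= #|T|%:R * E3.
  have : 0 <= \sum_x \sum_y (s x - s y) ^+ 2 by apply: sumr_ge0 => x _; apply: sumr_ge0 => y _; apply: sqr_ge0.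
  have -> : \sum_x \sum_y (s x - s y) ^+ 2 = 2 * (#|T|%:R * E3 - E2 ^+ 2).
    transitivity (\sum_x (#|T|%:R * s x ^+ 2 + - 2 * s x * E2 + E3)).
      apply: eq_bigr => x _; rewrite /E2 /E3 mulr_sumr.
      have -> : #|T|%:R * s x ^+ 2 = \sum_(y : T) s x ^+ 2 by rewrite sumr_const mulr_natl.
      by rewrite -!big_split /=; apply: eq_bigr => y _; ring.
    rewrite !big_split /= -mulr_sumr -mulr_suml -mulr_sumr sumr_const -/E2 -/E3 -mulr_natl.
    by ring.
  by rewrite pmulr_rge0 // subr_ge0.
have HkR : 2 ^+ 52 * #|T|%:R ^+ 3 <= d%:R ^+ 2 * E3.
  by rewrite E3E dE natrX -exprM -!natrX -!natrM ler_nat.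
clear Hk.
have large : 2 ^+ 26 * E2 ^+ 3 <= d%:R * E3 ^+ 2.
  have nn : 0 <= d%:R * E3 ^+ 2 by rewrite mulr_ge0 ?ler0n ?exprn_ge0.
  rewrite -ler_sqr ?nnegrE ?mulr_ge0 ?exprn_ge0 //.
  have -> : (2 ^+ 26 * E2 ^+ 3) ^+ 2 = 2 ^+ 52 * (E2 ^+ 2) ^+ 3 by rewrite exprMn -!exprM.
  have -> : (d%:R * E3 ^+ 2) ^+ 2 = d%:R ^+ 2 * E3 * E3 ^+ 3 by ring.
  apply: (@le_trans _ _ (2 ^+ 52 * (#|T|%:R * E3) ^+ 3)).
    apply: ler_wpM2l; first exact: exprn_ge0.
    by apply: lerXn2r; rewrite ?nnegrE ?sqr_ge0 ?mulr_ge0 ?ler0n.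
  rewrite exprMn mulrA; by apply: ler_wpM2r => //; apply: exprn_ge0.
have [u u0 Hu] := @separating_vector R T d v (cell fs) (@cell_sym fs) (@cell_trans fs) d0 E0 large.
exists (pol_of_row u); split; [exact: pdeg_pol_of_row | exact: nonzero_pol_of_row |].
rewrite -(@ler_nat R) [(512 * _)%:R]natrM [(511 * _)%:R]natrM -E3E.
have cellE x y : cell (pol_of_row u :: fs) x y = (0 < dot u (v x) * dot u (v y)) && cell fs x y.
  by rewrite /cell /same_cell /= !peval_pol_of_row.
pose L := \sum_x s x * #|[pred y | cell fs x y && ~~ (0 < dot u (v x) * dot u (v y))]|%:R.
have {}Hu : E3 <= 512 * L := Hu.
(* If [x] keeps [p] of the [p + q] points of its cell, then [(p + q)^2 - p^2 >= (p + q) q]. *)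
suff : (energy (pol_of_row u :: fs))%:R <= E3 - L.
  by move: Hu; move: (E3) (L) ((energy _)%:R) => a b c; lra.
rewrite /L /energy natr_sum /E3 -sumrB; apply: ler_sum => x _.
rewrite natrX /s -(cardID [pred y | 0 < dot u (v x) * dot u (v y)] (cell fs x)) natrD.
set p := #|_|; set q := #|[predD _ & _]|; set p' := #|_|; set q' := #|_|.
have -> : p = p'.
  by apply: eq_card => y; rewrite [RHS]inE; transitivity (cell (pol_of_row u :: fs) x y); rewrite // cellE andbC.
have -> : q' = q.
  by apply: eq_card => y; rewrite !inE andbC.
have := ler0n R p'; have := ler0n R q; nra.
Qed.

(** Steps of one fixed degree are repeated, unless the energy becomes too small for [energy_step],
    which is the first alternative. *)
Lemma iterated_steps k fs N :
  exists gs, [/\ (size gs <= N)%N,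
    forall g, g \in gs -> (pdeg g <= 3 * k)%N /\ nonzero3 g &
    (k ^ 6 * energy (gs ++ fs) < 2 ^ 52 * #|T| ^ 3)%N
     \/ (512 ^ N * energy (gs ++ fs) <= 511 ^ N * energy fs)%N].
Proof.
elim: N => [|N [gs [szg Hg HE]]]; first by exists [::]; split => //; right; rewrite !expn0.
have [done|more] := ltnP (k ^ 6 * energy (gs ++ fs)) (2 ^ 52 * #|T| ^ 3).
  by exists gs; split => //; [apply: leqW | left].
have {HE} HE : (512 ^ N * energy (gs ++ fs) <= 511 ^ N * energy fs)%N.
  by case: HE => //; rewrite ltnNge more.
have [E0|E0] := posnP (energy (gs ++ fs)).
  by exists gs; split => //; [apply: leqW | right; rewrite E0 muln0].
have [f [df nf Ef]] := energy_step E0 more.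
exists (f :: gs); split => //.
  by move=> g; rewrite inE => /orP[/eqP->|/Hg].
right; rewrite !expnS /= mulnAC -!mulnA [(energy _ * _)%N]mulnC.
rewrite mulnCA; apply: (@leq_trans (512 ^ N * (511 * energy (gs ++ fs)))).
  by rewrite leq_mul2l Ef orbT.
by rewrite mulnCA leq_mul2l HE orbT.
Qed.

End Partition.

Lemma exists_decay (q m : nat) : (0 < q)%N -> exists N, (m * q ^ N <= q.+1 ^ N)%N.
Proof.
move=> q0; exists (q * m)%N; rewrite -(@ler_nat rat) natrM !natrX.
have q0R : 0 < q%:R :> rat by rewrite ltr0n.
have le1 : -1 <= q%:R^-1 :> rat by apply: (@le_trans _ _ 0); rewrite ?invr_ge0 ?ler0n // lerN10.
have -> : q.+1%:R = q%:R * (1 + q%:R^-1) :> rat.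
  by rewrite mulrDr mulr1 divff ?gt_eqF // -natr1.
rewrite exprMn [leRHS]mulrC; apply: ler_wpM2r; first by rewrite exprn_ge0 // ltW.
apply: le_trans (bernoulli (q * m) le1).
by rewrite natrM mulrAC divff ?gt_eqF // mul1r lerDr ler01.
Qed.

(* The energies decrease geometrically while the degrees used increase
   geometrically, so the total degree is dominated by the last stage. *)
Lemma polynomial_partition (R : realType) : exists C, forall (T : finType) (pts : T -> pt3 R) J,
  exists fs : seq (pol3 R),
  [/\ (\sum_(f <- fs) pdeg f <= C * 2 ^ J)%N, forall f, f \in fs -> nonzero3 f &
   (64 ^ J * \sum_x #|fun y => same_cell fs (pts x) (pts y)| ^ 2 <= #|T| ^ 3)%N].
Proof.
have [N HN] := @exists_decay 511 64 isT.
(* With this [k0], a stage that stops early has also gained its factor 64. *)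
have [k0 Hk0] : exists k0, (64 * 2 ^ 52 <= k0 ^ 6)%N.
  by exists (2 ^ 10)%N; rewrite -[64%N]/(2 ^ 6)%N -expnD -expnM leq_exp2l.
have [C HC] : exists C, C = (N * (3 * k0))%N by exists (N * (3 * k0))%N.
exists C => T pts; elim=> [|J [fs [dfs nfs Efs]]].
  exists [::]; split => //; first by rewrite big_nil.
  rewrite expn0 mul1n (eq_bigr (fun=> (#|T| ^ 2)%N)); last by move=> x _; congr (_ ^ 2)%N; apply: eq_card.
  by rewrite sum_nat_const -expnS.
(* Stage [J] adds at most [N] polynomials of degree [3 k0 2^J], which doubles the total degree bound
   and divides the energy bound by [64 = 2^6]. *)
have [gs [szg Hg HE]] := iterated_steps pts (k0 * 2 ^ J) fs N.
exists (gs ++ fs); split.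
- rewrite big_cat /= expnS mulnCA mul2n -addnn; apply: leq_add => //.
  apply: (@leq_trans (\sum_(g <- gs) 3 * (k0 * 2 ^ J))).
    by rewrite !big_seq; apply: leq_sum => g /Hg[].
  by rewrite big_const_seq count_predT iter_addn_0 mulnC HC [(3 * (_ * _))%N]mulnA mulnA leq_mul2r leq_mul2r szg !orbT.
- by move=> f; rewrite mem_cat => /orP[/Hg[]|/nfs].
move: HE; set E := (\sum_x _)%N; set E' := (\sum_x _)%N => HE.
case: HE => HE.
- have p52 : (0 < 2 ^ 52)%N by rewrite expn_gt0.
  rewrite -(leq_pmul2l p52); apply: leq_trans (ltnW HE).
  move: (2 ^ 52)%N Hk0 => p Hk0; rewrite expnMn -expnM [(J * 6)%N]mulnC expnM expnS !mulnA leq_mul2r leq_mul2r.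
  by rewrite [(_ * 64)%N]mulnC Hk0 !orbT.
- have p511 : (0 < 511 ^ N)%N by rewrite expn_gt0.
  rewrite -(leq_pmul2l p511) expnS.
  apply: (@leq_trans (64 ^ J * (512 ^ N * E))).
    by rewrite mulnCA !mulnA leq_mul2r mulnC !mulnA [(_ * 64)%N]mulnC mulnC leq_mul2l HN !orbT.
  apply: leq_trans (_ : 64 ^ J * (511 ^ N * E') <= _)%N; first by rewrite leq_mul2l HE orbT.
  by rewrite mulnCA leq_mul2l Efs orbT.
Qed.

(** * Restriction of polynomials to rational curves *)

(** Terms free of the variable are removed rather than given coefficient 0, because [pdeg] counts
    every listed term. *)
Definition pdx (R : pzSemiRingType) (f : pol3 R) : pol3 R :=
  [seq (t.1 * t.2.1.1%:R, (t.2.1.1.-1, t.2.1.2, t.2.2)) | t <- f & (0 < t.2.1.1)%N].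
Definition pdy (R : pzSemiRingType) (f : pol3 R) : pol3 R :=
  [seq (t.1 * t.2.1.2%:R, (t.2.1.1, t.2.1.2.-1, t.2.2)) | t <- f & (0 < t.2.1.2)%N].
Definition pdz (R : pzSemiRingType) (f : pol3 R) : pol3 R :=
  [seq (t.1 * t.2.2%:R, (t.2.1.1, t.2.1.2, t.2.2.-1)) | t <- f & (0 < t.2.2)%N].

Section PartialDerivatives.
Variable R : realType.
Implicit Types (f : pol3 R) (p : pt3 R) (Y : pt3 {poly R}) (q : {poly R}).

Lemma peval_pdx f p : peval (pdx f) p =
  \sum_(t <- f) t.1 * (t.2.1.1%:R * p.1.1 ^+ t.2.1.1.-1 * p.1.2 ^+ t.2.1.2 * p.2 ^+ t.2.2).
Proof.
rewrite /peval big_map big_filter big_mkcond; apply: eq_bigr => t _ /=.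
by case: posnP => [->|_]; rewrite /mon3 /= ?mul0r ?mulr0 // ?mulrA.
Qed.

Lemma peval_pdy f p : peval (pdy f) p =
  \sum_(t <- f) t.1 * (p.1.1 ^+ t.2.1.1 * (t.2.1.2%:R * p.1.2 ^+ t.2.1.2.-1) * p.2 ^+ t.2.2).
Proof.
rewrite /peval big_map big_filter big_mkcond; apply: eq_bigr => t _ /=.
by case: posnP => [->|_]; rewrite /mon3 /=; ring.
Qed.

Lemma peval_pdz f p : peval (pdz f) p =
  \sum_(t <- f) t.1 * (p.1.1 ^+ t.2.1.1 * p.1.2 ^+ t.2.1.2 * (t.2.2%:R * p.2 ^+ t.2.2.-1)).
Proof.
rewrite /peval big_map big_filter big_mkcond; apply: eq_bigr => t _ /=.
by case: posnP => [->|_]; rewrite /mon3 /=; ring.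
Qed.

Lemma mem_pdeg f t : t \in f -> (t.2.1.1 + t.2.1.2 + t.2.2 <= pdeg f)%N.
Proof. by move=> tf; rewrite /pdeg (big_rem t) //= leq_maxl. Qed.

Lemma pdeg_partials f m : (pdeg f <= m.+1)%N ->
  [/\ (pdeg (pdx f) <= m)%N, (pdeg (pdy f) <= m)%N & (pdeg (pdz f) <= m)%N].
Proof.
move=> fm; split; rewrite /pdeg big_map big_filter big_seq_cond;
  apply/bigmax_leqP_seq => t _ /andP[/mem_pdeg tf t0] /=;
  have := leq_trans tf fm; move: t.2.1.1 t.2.1.2 t.2.2 t0 => i j k; lia.
Qed.

Lemma sum_exp_const (I : Type) (r : seq I) (a : I -> R) (n : I -> nat) :
  (forall x, \sum_(t <- r) a t * ((n t)%:R * x ^+ (n t).-1) = 0) ->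
  forall x, \sum_(t <- r) a t * x ^+ n t = \sum_(t <- r) a t * 0 ^+ n t.
Proof.
move=> H x; pose P : {poly R} := \sum_(t <- r) a t *: 'X^(n t).
have PE y : P.[y] = \sum_(t <- r) a t * y ^+ n t.
  by rewrite horner_sum; apply: eq_bigr => t _; rewrite hornerZ hornerXn.
have dP : P^`() = 0.
  apply: poly0_of_horner0 => y; rewrite -[RHS](H y) /P raddf_sum horner_sum /=.
  apply: eq_bigr => t _; rewrite derivZ derivXn hornerZ hornerMn hornerXn.
  by rewrite mulr_natl.
have -> : \sum_(t <- r) a t * x ^+ n t = P.[x] by rewrite PE.
rewrite -PE (size1_polyC (p := P)) ?hornerC //.
apply/leq_sizeP => -[|j] // _.
have := congr1 (fun q : {poly R} => q`_j) dP; rewrite coef_deriv coef0 => /eqP.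
by rewrite mulrn_eq0 => /orP[|/eqP].
Qed.

Lemma peval_const f : (forall p, peval (pdx f) p = 0) -> (forall p, peval (pdy f) p = 0) ->
  (forall p, peval (pdz f) p = 0) -> forall p, peval f p = peval f (0, 0, 0).
Proof.
move=> Hx Hy Hz [[x y] z].
transitivity (peval f (0, y, z)).
  transitivity (\sum_(t <- f) (t.1 * y ^+ t.2.1.2 * z ^+ t.2.2) * x ^+ t.2.1.1).
    by apply: eq_bigr => t _; rewrite /mon3 /=; ring.
  rewrite sum_exp_const; first by apply: eq_bigr => t _; rewrite /mon3 /=; ring.
  move=> u; rewrite -[RHS](Hx (u, y, z)) peval_pdx.
  by apply: eq_bigr => t _ /=; ring.
transitivity (peval f (0, 0, z)).
  transitivity (\sum_(t <- f) (t.1 * 0 ^+ t.2.1.1 * z ^+ t.2.2) * y ^+ t.2.1.2).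
    by apply: eq_bigr => t _; rewrite /mon3 /=; ring.
  rewrite sum_exp_const; first by apply: eq_bigr => t _; rewrite /mon3 /=; ring.
  move=> u; rewrite -[RHS](Hy (0, u, z)) peval_pdy.
  by apply: eq_bigr => t _ /=; ring.
transitivity (\sum_(t <- f) (t.1 * 0 ^+ t.2.1.1 * 0 ^+ t.2.1.2) * z ^+ t.2.2).
  by apply: eq_bigr => t _; rewrite /mon3 /=; ring.
rewrite sum_exp_const; first by apply: eq_bigr => t _; rewrite /mon3 /=; ring.
move=> u; rewrite -[RHS](Hz (0, 0, u)) peval_pdz.
by apply: eq_bigr => t _ /=; ring.
Qed.

(* The numerator of f(Y1/q, Y2/q, Y3/q) over the denominator q^m. *)
Definition ratcomp m f (Y : pt3 {poly R}) (q : {poly R}) : {poly R} :=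
  \sum_(t <- f) t.1 *: (mon3 Y t.2 * q ^+ (m - (t.2.1.1 + t.2.1.2 + t.2.2))).

Lemma horner_ratcomp m f Y q s : (pdeg f <= m)%N -> q.[s] != 0 ->
  (ratcomp m f Y q).[s] =
    q.[s] ^+ m * peval f (Y.1.1.[s] / q.[s], Y.1.2.[s] / q.[s], Y.2.[s] / q.[s]).
Proof.
move=> fm q0; rewrite horner_sum /peval mulr_sumr big_seq [RHS]big_seq.
apply: eq_bigr => t /mem_pdeg tf; rewrite hornerZ /mon3 /= !hornerM !horner_exp.
have {2}-> : m = (t.2.1.1 + t.2.1.2 + t.2.2 + (m - (t.2.1.1 + t.2.1.2 + t.2.2)))%N.
  by rewrite subnKC // (leq_trans tf).
rewrite !exprD !expr_div_n; move: (m - _)%N => e.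
by field; rewrite !expf_neq0.
Qed.

Lemma size_ratcomp m f Y q : (pdeg f <= m)%N -> (size Y.1.1 <= 3)%N -> (size Y.1.2 <= 3)%N ->
  (size Y.2 <= 3)%N -> (size q <= 3)%N -> (size (ratcomp m f Y q) <= (2 * m).+1)%N.
Proof.
have szX (P : {poly R}) n : (size P <= 3)%N -> (size (P ^+ n) <= (2 * n).+1)%N.
  move=> P3; apply: leq_trans (size_poly_exp_leq _ _) _; rewrite ltnS leq_mul2r.
  by apply/orP; right; case: (size P) P3.
have szM (P Q : {poly R}) i j : (size P <= i.+1)%N -> (size Q <= j.+1)%N ->
    (size (P * Q)%R <= (i + j).+1)%N.
  move=> Pi Qj; apply: leq_trans (size_polyMleq _ _) _.
  by move: (size P) (size Q) Pi Qj => a b; lia.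
move=> fm Y1 Y2 Y3 q3; rewrite /ratcomp big_seq.
apply: (leq_trans (size_sum _ _ _)); apply/bigmax_leqP_seq => t _ /mem_pdeg tf.
apply: leq_trans (size_scale_leq _ _) _.
have := szM _ _ _ _ (szM _ _ _ _ (szM _ _ _ _ (szX _ t.2.1.1 Y1) (szX _ t.2.1.2 Y2)) (szX _ t.2.2 Y3))
  (szX _ (m - (t.2.1.1 + t.2.1.2 + t.2.2))%N q3).
move/leq_trans; apply; rewrite ltnS.
by have := leq_trans tf fm; move: t.2.1.1 t.2.1.2 t.2.2 => i j k; lia.
Qed.

(** The chain rule at a parameter where the denominator is 1 with derivative 0. *)
Lemma deriv_ratcomp m f Y q : (pdeg f <= m)%N -> q.[0] = 1 -> q^`().[0] = 0 ->
  let p := (Y.1.1.[0], Y.1.2.[0], Y.2.[0]) in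
  (ratcomp m f Y q)^`().[0] = peval (pdx f) p * Y.1.1^`().[0]
    + peval (pdy f) p * Y.1.2^`().[0] + peval (pdz f) p * Y.2^`().[0].
Proof.
move=> fm q1 dq /=; rewrite peval_pdx peval_pdy peval_pdz !mulr_suml -!big_split /=.
rewrite /ratcomp raddf_sum horner_sum /=; apply: eq_bigr => t _.
rewrite derivZ hornerZ /mon3 !(derivM, deriv_exp) !(hornerD, hornerM, hornerMn, horner_exp) dq q1.
rewrite !expr1n mul0r mul0rn mulr0 addr0 mulr1 -![(_ * _) *+ _]mulr_natr.
move: (t.2.1.1%:R) (t.2.1.2%:R) (t.2.2%:R) => i j k.
move: (Y.1.1.[0] ^+ t.2.1.1) (Y.1.2.[0] ^+ t.2.1.2) (Y.2.[0] ^+ t.2.2) => x y z.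
move: (Y.1.1.[0] ^+ _) (Y.1.2.[0] ^+ _) (Y.2.[0] ^+ _) => x' y' z'.
by ring.
Qed.

End PartialDerivatives.

(** * Circles of similar triangles *)

Section Vectors.
Variable R : realType.
Implicit Types (p q u w z : pt3 R) (t : R).

Definition vadd p q : pt3 R := (p.1.1 + q.1.1, p.1.2 + q.1.2, p.2 + q.2).
Definition vsub p q : pt3 R := (p.1.1 - q.1.1, p.1.2 - q.1.2, p.2 - q.2).
Definition vscale t p : pt3 R := (t * p.1.1, t * p.1.2, t * p.2).
Definition vdot p q : R := p.1.1 * q.1.1 + p.1.2 * q.1.2 + p.2 * q.2.
Definition vcross p q : pt3 R :=
  (p.1.2 * q.2 - p.2 * q.1.2, p.2 * q.1.1 - p.1.1 * q.2, p.1.1 * q.1.2 - p.1.2 * q.1.1).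

Lemma pt3P p q : p.1.1 = q.1.1 -> p.1.2 = q.1.2 -> p.2 = q.2 -> p = q.
Proof. by case: p q => [[? ?] ?] [[? ?] ?] /= -> -> ->. Qed.

Lemma vdotC p q : vdot p q = vdot q p.
Proof. by rewrite /vdot; ring. Qed.

Lemma vdotZr t p q : vdot p (vscale t q) = t * vdot p q.
Proof. by rewrite /vdot /=; ring. Qed.

Lemma vdot_ge0 p : 0 <= vdot p p.
Proof. by rewrite /vdot -!expr2 !addr_ge0 ?sqr_ge0. Qed.

Lemma vdot_eq0 p : vdot p p = 0 -> p = (0, 0, 0).
Proof.
case: p => [[x y] z]; rewrite /vdot /= => H.
have X0 : x ^+ 2 = 0 by have := sqr_ge0 x; have := sqr_ge0 y; have := sqr_ge0 z; nra.
have Y0 : y ^+ 2 = 0 by have := sqr_ge0 x; have := sqr_ge0 y; have := sqr_ge0 z; nra.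
have Z0 : z ^+ 2 = 0 by have := sqr_ge0 x; have := sqr_ge0 y; have := sqr_ge0 z; nra.
by move/eqP: X0; move/eqP: Y0; move/eqP: Z0; rewrite !sqrf_eq0 => /eqP-> /eqP-> /eqP->.
Qed.

Lemma vsub_eq0 p q : vsub p q = (0, 0, 0) -> p = q.
Proof.
by case: p q => [[? ?] ?] [[? ?] ?] [] /= /eqP + /eqP + /eqP; rewrite !subr_eq0 => /eqP-> /eqP-> /eqP->.
Qed.

Lemma vscale_inj t p q : t != 0 -> vscale t p = vscale t q -> p = q.
Proof. by move=> t0 [] /(mulfI t0) ? /(mulfI t0) ? /(mulfI t0) ?; apply: pt3P. Qed.

(** Expansion of [z] along [vcross w u] and, through the dual basis, along [w] and [u], with the
    Gram determinant as common denominator. *)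
Lemma vcross_decomp z w u : vscale (vdot (vcross w u) (vcross w u)) z =
  vadd (vscale (vdot z (vcross w u)) (vcross w u))
    (vadd (vscale (vdot z w) (vsub (vscale (vdot u u) w) (vscale (vdot w u) u)))
          (vscale (vdot z u) (vsub (vscale (vdot w w) u) (vscale (vdot w u) w)))).
Proof. by apply: pt3P; rewrite /vdot /vcross /=; ring. Qed.

Lemma vcross_sqr w u : vdot (vcross w u) (vcross w u) = vdot w w * vdot u u - vdot w u ^+ 2.
Proof. by rewrite /vdot /vcross /=; ring. Qed.

Lemma vcross_orthogonal z w u : vcross w u != (0, 0, 0) ->
  vdot z w = 0 -> vdot z u = 0 -> vdot z (vcross w u) = 0 -> z = (0, 0, 0).
Proof.
move=> n0 zw zu zn.
have nn : vdot (vcross w u) (vcross w u) != 0 by apply: contraNneq n0 => /vdot_eq0 ->.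
apply: (vscale_inj nn); rewrite vcross_decomp zw zu zn.
by apply: pt3P; rewrite /=; ring.
Qed.

Lemma vcross_parallel z w u : vdot z w = 0 -> vdot z u = 0 ->
  vscale (vdot (vcross w u) (vcross w u)) z = vscale (vdot z (vcross w u)) (vcross w u).
Proof.
by move=> zw zu; rewrite vcross_decomp zw zu; apply: pt3P; rewrite /=; ring.
Qed.

(* In the plane spanned by w and g, a vector with prescribed scalar product
   with w and prescribed length is unique up to the reflection in w. *)
Lemma coplanar_unique w g y y' (e := vcross w (vcross g w)) : vcross w g != (0, 0, 0) ->
  vdot g (vcross w y) = 0 -> vdot g (vcross w y') = 0 ->
  vdot y w = vdot y' w -> vdot y y = vdot y' y' ->
  (0 <= vdot y e) = (0 <= vdot y' e) -> y = y'.
Proof.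
move=> n0 gy gy' yw yy sgn; apply: vsub_eq0.
have n0' : vcross w (vcross g w) != (0, 0, 0).
  apply: contraNneq n0 => H; have : vdot (vcross w g) (vcross w g) ^+ 2 = 0; last first.
    by move/eqP; rewrite sqrf_eq0 => /eqP /vdot_eq0 ->.
  have := congr1 (fun q => vdot q q) H.
  have -> : vdot (vcross w (vcross g w)) (vcross w (vcross g w)) =
     vdot w w * vdot (vcross w g) (vcross w g) by rewrite /vdot /vcross /=; ring.
  rewrite [RHS](_ : _ = 0); last by rewrite /vdot /=; ring.
  move/eqP; rewrite mulf_eq0 => /orP[/eqP/vdot_eq0 -> | /eqP -> ]; rewrite ?expr0n //.
  by rewrite /vdot /vcross /=; ring.
have zw : vdot (vsub y y') w = 0.
  have -> : vdot (vsub y y') w = vdot y w - vdot y' w by rewrite /vdot /=; ring.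
  by rewrite yw subrr.
have zg : vdot (vsub y y') (vcross g w) = 0.
  have -> : vdot (vsub y y') (vcross g w) = vdot g (vcross w y) - vdot g (vcross w y').
    by rewrite /vdot /vcross /=; ring.
  by rewrite gy gy' subrr.
apply: (@vcross_orthogonal _ w (vcross g w)) => //.
have par := vcross_parallel zw zg.
have zs : vdot (vsub y y') (vadd y y') = 0.
  have -> : vdot (vsub y y') (vadd y y') = vdot y y - vdot y' y' by rewrite /vdot /=; ring.
  by rewrite yy subrr.
(* The difference is parallel to [e] and orthogonal to the sum; so either the difference has no
   component along [e], or the components of [y] and [y'] are opposite, and equal signs exclude a
   nonzero pair. *)
have : vdot (vsub y y') e * (vdot y e + vdot y' e) = 0.
  have := congr1 (fun q => vdot q (vadd y y')) par.
  rewrite ![vdot (vscale _ _) _]vdotC !vdotZr ![vdot (vadd _ _) _]vdotC.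
  rewrite zs mulr0 => /esym; rewrite -/e => <-; congr (_ * _).
  by rewrite /vdot /=; ring.
have ve : vdot (vsub y y') e = vdot y e - vdot y' e by rewrite /vdot /=; ring.
move/eqP; rewrite mulf_eq0 => /orP[/eqP //|/eqP].
rewrite -/e ve; move: sgn; case: (lerP 0 (vdot y e)) => ye /esym.
  by move=> ye'; lra.
by move/negbT; rewrite -ltNge; lra.
Qed.

End Vectors.

(* For a triangle with |pq|^2 = A, |qr|^2 = B, |rp|^2 = C, similarity of abc to
   pqr is expressed with kap = (A + C - B)/(2A) and rho = C/A. *)
Definition simtri (R : realType) (kap rho : R) (a b c : pt3 R) : bool :=
  let u := vsub b a in let w := vsub c a in
  [&& vdot u u != 0, vdot u w == kap * vdot u u & vdot w w == rho * vdot u u].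

Section Circle.
Variables (R : realType) (kap rho : R).
Hypothesis kap_rho : kap ^+ 2 < rho.
Let sim := simtri kap rho.
Implicit Types (a b c y : pt3 R).

Let center a b := vadd a (vscale kap (vsub b a)).
Let sqlen a b := vdot (vsub b a) (vsub b a).

Lemma sqlen_gt0 a b c : sim a b c -> 0 < sqlen a b.
Proof. by case/and3P => u0 _ _; rewrite lt_def u0 vdot_ge0. Qed.

(** Pythagoras at the foot [center a b] of the altitude: [kap] places the foot on the line ab, and
    [rho - kap^2] is the squared height in units of [|ab|^2]. *)
Lemma circleP a b y : reflect
  [/\ sqlen a b != 0, vdot (vsub y (center a b)) (vsub b a) = 0 &
      vdot (vsub y (center a b)) (vsub y (center a b)) = (rho - kap ^+ 2) * sqlen a b]
  (sim a b y).
Proof.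
have e1 : vdot (vsub y (center a b)) (vsub b a) =
    vdot (vsub b a) (vsub y a) - kap * sqlen a b.
  by rewrite /sqlen /center /vdot /=; ring.
have e2 : vdot (vsub y (center a b)) (vsub y (center a b)) =
    vdot (vsub y a) (vsub y a) - 2 * kap * vdot (vsub b a) (vsub y a) + kap ^+ 2 * sqlen a b.
  by rewrite /sqlen /center /vdot /=; ring.
rewrite e1 e2 /sim /simtri -/(sqlen a b); apply: (iffP and3P) => -[u0 H1 H2]; split => //.
- by rewrite (eqP H1) subrr.
- by rewrite (eqP H1) (eqP H2); ring.
- by apply/eqP; lra.
- apply/eqP; have H1' : vdot (vsub b a) (vsub y a) = kap * sqlen a b by lra.
  by move: H2; rewrite H1' => H2; lra.
Qed.

Section Base.
Variables a b c : pt3 R.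
Hypothesis abc : sim a b c.
Let u := vsub b a.
Let U := vdot u u.
Let o := center a b.
Let w := vsub o c.
Let v := vcross (vsub a c) (vsub b c).
Let r2 := (rho - kap ^+ 2) * U.

Lemma side_sqr_gt0 : 0 < U. Proof. exact: sqlen_gt0 abc. Qed.

Lemma radius_sqr_gt0 : 0 < r2.
Proof. by rewrite mulr_gt0 ?side_sqr_gt0 // subr_gt0. Qed.

(** The normal of the plane abc is tangent to the circle at [c], being orthogonal to the axis and to
    the radius. *)
Lemma tangent_cross : v = vcross w u.
Proof. by apply: pt3P; rewrite /v /w /o /u /center /=; ring. Qed.

Lemma radius_orthogonal : vdot w u = 0.
Proof.
case/circleP: abc => _ H _; rewrite /w /u.
have -> : vdot (vsub o c) (vsub b a) = - vdot (vsub c (center a b)) (vsub b a).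
  by rewrite /o /vdot /=; ring.
by rewrite H oppr0.
Qed.

Lemma radius_sqr : vdot w w = r2.
Proof.
case/circleP: abc => _ _ H; rewrite -[RHS]H /w /o /vdot /=; ring.
Qed.

Lemma tangent_sqr : vdot v v = U * r2.
Proof. by rewrite tangent_cross vcross_sqr radius_orthogonal radius_sqr -/U; ring. Qed.

Lemma tangent_neq0 : v != (0, 0, 0).
Proof.
apply/eqP => v0; have := mulr_gt0 side_sqr_gt0 radius_sqr_gt0.
by rewrite -tangent_sqr v0 /vdot /= mulr0 !addr0 ltxx.
Qed.

Definition circle_pt (A B : R) : pt3 R := vadd o (vadd (vscale A w) (vscale B v)).

Lemma circle_pt_sim A B : A ^+ 2 + U * B ^+ 2 = 1 -> sim a b (circle_pt A B).
Proof.
move=> AB; apply/circleP; split; first by rewrite gt_eqF ?side_sqr_gt0.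
  have -> : vdot (vsub (circle_pt A B) (center a b)) (vsub b a) = A * vdot w u + B * vdot v u.
    by rewrite -/o -/u /circle_pt /vdot /=; ring.
  by rewrite radius_orthogonal tangent_cross /vdot /vcross /=; ring.
have -> : vdot (vsub (circle_pt A B) (center a b)) (vsub (circle_pt A B) (center a b)) =
   A ^+ 2 * vdot w w + B ^+ 2 * vdot v v + 2 * A * B * vdot w v.
  by rewrite -/o /circle_pt /vdot /=; ring.
rewrite radius_sqr tangent_sqr.
have -> : vdot w v = 0 by rewrite tangent_cross /vdot /vcross /=; ring.
by rewrite mulr0 addr0 mulrA -mulrDl [B ^+ 2 * U]mulrC AB mul1r.
Qed.

Let coordA y := vdot (vsub y o) w / r2.
Let coordB y := vdot (vsub y o) v / (U * r2).

Lemma circle_coord y : sim a b y ->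
  coordA y ^+ 2 + U * coordB y ^+ 2 = 1 /\ y = circle_pt (coordA y) (coordB y).
Proof.
case/circleP => _ zu zz; set z := vsub y o; have U0 := side_sqr_gt0; have r0 := radius_sqr_gt0.
have dec : vscale (U * r2) z = vadd (vscale (vdot z v) v) (vscale (U * vdot z w) w).
  rewrite -tangent_sqr tangent_cross vcross_decomp radius_orthogonal (_ : vdot z u = 0) // -/U.
  by apply: pt3P; rewrite /=; ring.
split.
  have := congr1 (vdot z) dec.
  have -> : vdot z (vscale (U * r2) z) = U * r2 * vdot z z by rewrite /vdot /=; ring.
  have -> : vdot z (vadd (vscale (vdot z v) v) (vscale (U * vdot z w) w)) =
    vdot z v ^+ 2 + U * vdot z w ^+ 2 by rewrite /vdot /=; ring.
  rewrite (_ : vdot z z = r2) // => H.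
  rewrite /coordA /coordB -/z.
  have -> : (vdot z w / r2) ^+ 2 + U * (vdot z v / (U * r2)) ^+ 2 =
     (vdot z v ^+ 2 + U * vdot z w ^+ 2) / (U * r2 * r2).
    by field; rewrite !gt_eqF.
  by rewrite -H divff // gt_eqF //; do 2![apply: mulr_gt0 => //].
have Ur0 : U * r2 != 0 by rewrite gt_eqF // mulr_gt0.
have : z = vadd (vscale (coordA y) w) (vscale (coordB y) v).
  apply: (vscale_inj Ur0); rewrite dec /coordA /coordB -/z.
  by apply: pt3P; rewrite /=; field; rewrite !gt_eqF.
move=> H; rewrite /circle_pt -H.
by apply: pt3P; rewrite /z /=; ring.
Qed.

(** Stereographic projection from the antipode [circle_pt 1 0] of [c]; the parameter 0 gives [c]. *)
Let chart (s : R) : pt3 R :=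
  circle_pt ((U * s ^+ 2 - 1) / (1 + U * s ^+ 2)) (2 * s / (1 + U * s ^+ 2)).

Lemma chart_den s : 0 < 1 + U * s ^+ 2.
Proof. by rewrite ltr_pwDl // mulr_ge0 ?sqr_ge0 // ltW // side_sqr_gt0. Qed.

Lemma chart_sim s : sim a b (chart s).
Proof. by apply: circle_pt_sim; field; rewrite gt_eqF // chart_den. Qed.

Lemma chart_surj A B : A ^+ 2 + U * B ^+ 2 = 1 -> A != 1 -> circle_pt A B = chart (B / (1 - A)).
Proof.
move=> AB A1; rewrite /chart; have A10 : 1 - A != 0 by rewrite subr_eq0 eq_sym.
have e : U * (B / (1 - A)) ^+ 2 = (1 + A) / (1 - A).
  rewrite expr_div_n mulrA (_ : U * B ^+ 2 = (1 - A) * (1 + A)); last by lra.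
  by field.
rewrite e; congr circle_pt; field; rewrite A10 /=.
  by rewrite (_ : 1 - A + (1 + A) = 2) ?pnatr_eq0 //; ring.
by rewrite (_ : 1 - A + (1 + A) = 2) ?pnatr_eq0 //; ring.
Qed.

Let lin (i : pt3 R -> R) : {poly R} :=
  (i o - i w)%:P + (2 * i v) *: 'X + (U * (i o + i w)) *: 'X^2.
(** Coefficients in reverse order: the chart in the parameter [1/s], which reaches the antipode at
    0. *)
Let lin' (i : pt3 R -> R) : {poly R} :=
  (U * (i o + i w))%:P + (2 * i v) *: 'X + (i o - i w) *: 'X^2.
Let den : {poly R} := 1%:P + U *: 'X^2.
Let den' : {poly R} := U%:P + 'X^2.

Let x1 (p : pt3 R) := p.1.1.
Let x2 (p : pt3 R) := p.1.2.
Let x3 (p : pt3 R) := p.2.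

Definition chart_poly (f : pol3 R) : {poly R} :=
  ratcomp (pdeg f) f (lin x1, lin x2, lin x3) den.

Lemma size_quadratic (k l m : R) : (size (k%:P + l *: 'X + m *: 'X^2 : {poly R})%R <= 3)%N.
Proof.
apply/leq_sizeP => j; rewrite !coefD !coefZ coefC coefX coefXn.
by case: j => [|[|[|j]]] //= _; rewrite !mulr0 !addr0.
Qed.

Lemma horner_quadratic (k l m s : R) :
  (k%:P + l *: 'X + m *: 'X^2).[s] = k + l * s + m * s ^+ 2.
Proof. by rewrite !hornerD !hornerZ hornerC hornerX hornerXn. Qed.

Lemma deriv_quadratic (k l m : R) : (k%:P + l *: 'X + m *: 'X^2)^`().[0] = l.
Proof.
by rewrite !derivD !derivZ derivC derivX derivXn hornerD hornerD hornerC !hornerZ hornerMn hornerXn hornerC; ring.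
Qed.

Lemma size_chart_poly f : (size (chart_poly f) <= (2 * pdeg f).+1)%N.
Proof.
apply: size_ratcomp => //=; try exact: size_quadratic.
by have := size_quadratic 1 0 U; rewrite scale0r addr0.
Qed.

Lemma horner_den s : den.[s] = 1 + U * s ^+ 2.
Proof. by have := horner_quadratic 1 0 U s; rewrite scale0r addr0 mul0r addr0. Qed.

Lemma horner_chart_poly f s :
  (chart_poly f).[s] = (1 + U * s ^+ 2) ^+ pdeg f * peval f (chart s).
Proof.
have d0 := chart_den s.
rewrite /chart_poly horner_ratcomp //; last by rewrite horner_den gt_eqF.
rewrite horner_den; congr (_ * peval f _).
by rewrite /lin !horner_quadratic; apply: pt3P; rewrite /chart /circle_pt /x1 /x2 /x3 /=; field; rewrite gt_eqF.
Qed.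

Lemma chart_poly_eq0 f : chart_poly f = 0 -> forall y, sim a b y -> peval f y = 0.
Proof.
move=> G0; have f0 s : peval f (chart s) = 0.
  have := horner_chart_poly f s; rewrite G0 horner0 => /esym/eqP.
  by rewrite mulf_eq0 expf_eq0 (gt_eqF (chart_den s)) andbF => /eqP.
move=> y /circle_coord[AB ->]; move: AB; set A := coordA y; set B := coordB y.
have [A1 AB|A1 AB] := eqVneq A 1; last by rewrite chart_surj.
have U0 := side_sqr_gt0.
have -> : B = 0.
  by apply/eqP; rewrite -sqrf_eq0; apply/eqP; move: AB; rewrite A1; nra.
(* the antipode of c, reached by the opposite chart at parameter 0 *)
pose G' := ratcomp (pdeg f) f (lin' x1, lin' x2, lin' x3) den'.
have dE t : den'.[t] = U + t ^+ 2 by have := horner_quadratic U 0 1 t; rewrite scale0r scale1r addr0 mul0r addr0 mul1r.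
have dt t : 0 < U + t ^+ 2 by rewrite ltr_pwDl // sqr_ge0.
have G'0 : G' = 0.
  have : 'X * G' = 0.
    apply: poly0_of_horner0 => t; rewrite hornerM hornerX.
    have [->|t0] := eqVneq t 0; first by rewrite mul0r.
    rewrite /G' horner_ratcomp //; last by rewrite dE gt_eqF.
    rewrite -[X in peval f X](_ : chart t^-1 = _) ?f0 ?mulr0 //.
    rewrite dE /lin' !horner_quadratic; apply: pt3P; rewrite /chart /circle_pt /x1 /x2 /x3 /=;
      by field; rewrite t0 !gt_eqF.
  by move/eqP; rewrite mulf_eq0 polyX_eq0 => /eqP.
have := congr1 (fun q : {poly R} => q.[0]) G'0.
rewrite horner0 /G' horner_ratcomp //; last by rewrite dE gt_eqF.
move/eqP; rewrite mulf_eq0 expf_eq0 dE (gt_eqF (dt 0)) andbF /= => /eqP e; rewrite -[RHS]e.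
congr peval; rewrite A1.
by rewrite /lin' !horner_quadratic; apply: pt3P; rewrite /circle_pt /x1 /x2 /x3 /=; field; rewrite gt_eqF.
Qed.

(** The chart passes through [c] at parameter 0 with velocity [2 v], and [f] vanishes along it. *)
Lemma gradient_tangent f : (forall y, sim a b y -> peval f y = 0) ->
  vdot (peval (pdx f) c, peval (pdy f) c, peval (pdz f) c) v = 0.
Proof.
move=> f0; have G0 : chart_poly f = 0.
  by apply: poly0_of_horner0 => s; rewrite horner_chart_poly f0 ?mulr0 // chart_sim.
have := congr1 (fun q : {poly R} => q^`().[0]) G0.
rewrite /chart_poly deriv0 horner0 deriv_ratcomp //; last 2 first.
- by rewrite horner_den expr0n mulr0 addr0.
- by have := deriv_quadratic 1 0 U; rewrite scale0r addr0.
have cE : ((lin x1).[0], (lin x2).[0], (lin x3).[0]) = c.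
  by rewrite /lin !horner_quadratic; apply: pt3P; rewrite /x1 /x2 /x3 /w /=; ring.
have dl i : (lin i)^`().[0] = 2 * i v by rewrite /lin deriv_quadratic.
rewrite [fst (fst _)]/= [snd (fst _)]/= [snd _]/= cE !dl => H.
suff : 2 * vdot (peval (pdx f) c, peval (pdy f) c, peval (pdz f) c) v = 0.
  by move/eqP; rewrite mulf_eq0 pnatr_eq0 => /eqP.
by rewrite -[RHS]H /vdot /x1 /x2 /x3 /=; ring.
Qed.

(** The form used for counting: off one point [z], the parameter is injective and the sign of [f] is
    that of a univariate polynomial of degree at most [2 * pdeg f]. *)
Lemma circle_chart : exists (s : pt3 R -> R) (z : pt3 R),
  (forall y y', sim a b y -> sim a b y' -> y != z -> y' != z -> s y = s y' -> y = y') /\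
  forall f y, sim a b y -> y != z ->
    exists2 e, 0 < e & (chart_poly f).[s y] = e * peval f y.
Proof.
have key y : sim a b y -> y != circle_pt 1 0 -> y = chart (coordB y / (1 - coordA y)).
  move=> yab; have [AB yE] := circle_coord yab; rewrite {1}yE => yz.
  rewrite {1}yE; apply: chart_surj => //; apply: contraNneq yz => A1.
  have B0 : coordB y = 0.
    by apply/eqP; rewrite -sqrf_eq0; apply/eqP; move: AB side_sqr_gt0; rewrite A1; nra.
  by rewrite A1 B0.
exists (fun y => coordB y / (1 - coordA y)), (circle_pt 1 0); split.
  by move=> y y' yab yab' yz yz' H; rewrite (key y) // H -key.
move=> f y yab yz; rewrite horner_chart_poly -key //.
by exists ((1 + U * (coordB y / (1 - coordA y)) ^+ 2) ^+ pdeg f); rewrite ?exprn_gt0 ?chart_den.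
Qed.

End Base.
End Circle.

(** * Recovering the pair (a, b) from points or from a gradient *)

Section Uniqueness.
Variables (R : realType) (kap rho : R).
Hypothesis kap_rho : kap ^+ 2 < rho.
Let sim := simtri kap rho.
Implicit Types (a b c g : pt3 R).

Lemma vsub_neq0 (p q : pt3 R) : p != q -> 0 < vdot (vsub p q) (vsub p q).
Proof.
move=> pq; rewrite lt_def vdot_ge0 andbT; apply: contraNneq pq => H.
by apply/eqP/vsub_eq0/vdot_eq0.
Qed.

Lemma rho_gt0 : 0 < rho.
Proof. exact: le_lt_trans (sqr_ge0 kap) kap_rho. Qed.

(** A line meets the sphere about the centre at most twice: [e = t d] would give
    [t (t - 1) |d|^2 = 0]. *)
Lemma circle_noncollinear a b c1 c2 c3 : sim a b c1 -> sim a b c2 -> sim a b c3 ->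
  c1 != c2 -> c1 != c3 -> c2 != c3 -> vcross (vsub c2 c1) (vsub c3 c1) != (0, 0, 0).
Proof.
move=> /circleP-[_ _ H1] /circleP-[_ _ H2] /circleP-[_ _ H3] d12 d13 d23.
set o := vadd _ _ in H1 H2 H3; set r := (_ - _) * _ in H1 H2 H3.
set d := vsub c2 c1; set e := vsub c3 c1.
apply/eqP => n0.
have dd : 0 < vdot d d by apply: vsub_neq0; rewrite eq_sym.
have par : vscale (vdot d d) e = vscale (vdot d e) d.
  have -> : vscale (vdot d d) e = vsub (vscale (vdot d e) d) (vcross d (vcross d e)).
    by apply: pt3P; rewrite /vdot /vcross /=; ring.
  by rewrite n0; apply: pt3P; rewrite /vcross /=; ring.
have [t eE] : exists t, e = vscale t d.
  exists (vdot d e / vdot d d); apply: (vscale_inj (t := vdot d d)); first by rewrite gt_eqF.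
  by rewrite par; apply: pt3P; rewrite /=; field; rewrite gt_eqF.
have q1 : vdot d d + 2 * vdot (vsub c1 o) d = 0.
  have -> : vdot d d + 2 * vdot (vsub c1 o) d =
    vdot (vsub c2 o) (vsub c2 o) - vdot (vsub c1 o) (vsub c1 o) by rewrite /d /vdot /=; ring.
  by rewrite H1 H2 subrr.
have q2 : t ^+ 2 * vdot d d + t * (2 * vdot (vsub c1 o) d) = 0.
  have -> : t ^+ 2 * vdot d d + t * (2 * vdot (vsub c1 o) d) = vdot e e + 2 * vdot (vsub c1 o) e.
    by rewrite eE /vdot /=; ring.
  have -> : vdot e e + 2 * vdot (vsub c1 o) e =
    vdot (vsub c3 o) (vsub c3 o) - vdot (vsub c1 o) (vsub c1 o) by rewrite /e /vdot /=; ring.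
  by rewrite H1 H3 subrr.
have : t * (t - 1) * vdot d d = 0.
  by rewrite (_ : 2 * vdot _ _ = - vdot d d) in q2; [rewrite -[RHS]q2; ring | lra].
move/eqP; rewrite !mulf_eq0 (gt_eqF dd) orbF => /orP[/eqP t0|].
  case/eqP: d13; apply/esym/vsub_eq0; rewrite -/e eE t0.
  by apply: pt3P; rewrite /= mul0r.
rewrite subr_eq0 => /eqP t1; case/eqP: d23; apply/esym/vsub_eq0.
have : e = d by rewrite eE t1; apply: pt3P; rewrite /= mul1r.
by case=> + + +; rewrite /vsub => h1 h2 h3; apply: pt3P => /=; lra.
Qed.

(** Three points fix the axis direction [n] and the centre; the radius fixes [|b - a|], and the sign
    of the product with [n] fixes the orientation. Hence at most two pairs share three points. *)
Lemma circle_determined a b a' b' c1 c2 c3 (n := vcross (vsub c2 c1) (vsub c3 c1)) :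
  sim a b c1 -> sim a b c2 -> sim a b c3 ->
  sim a' b' c1 -> sim a' b' c2 -> sim a' b' c3 ->
  c1 != c2 -> c1 != c3 -> c2 != c3 ->
  (0 <= vdot (vsub b a) n) = (0 <= vdot (vsub b' a') n) -> a = a' /\ b = b'.
Proof.
move=> s1 s2 s3 s1' s2' s3' d12 d13 d23.
have n0 : n != (0, 0, 0) by apply: circle_noncollinear s1 s2 s3 d12 d13 d23.
move: s1 s2 s3 s1' s2' s3' => /circleP-[U0 P1 H1] /circleP-[_ P2 H2] /circleP-[_ P3 H3].
move=> /circleP-[U0' P1' H1'] /circleP-[_ P2' H2'] /circleP-[_ P3' H3'].
set o := vadd _ _ in H1 H2 H3 P1 P2 P3; set o' := vadd _ _ in H1' H2' H3' P1' P2' P3'.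
set u := vsub b a in P1 P2 P3 H1 H2 H3 U0 *.
set u' := vsub b' a' in P1' P2' P3' H1' H2' H3' U0' *.
set U := vdot u u in U0 H1 H2 H3; set U' := vdot u' u' in U0' H1' H2' H3'.
have nn : 0 < vdot n n.
  by rewrite lt_def vdot_ge0 andbT; apply: contraNneq n0 => /vdot_eq0 ->.
have perp (p q x y : pt3 R) : vdot (vsub x p) q = 0 -> vdot (vsub y p) q = 0 ->
    vdot q (vsub x y) = 0.
  move=> h1 h2; rewrite -[RHS](subrr 0) -{1}h1 -h2 /vdot /=; ring.
have par : vscale (vdot n n) u = vscale (vdot u n) n.
  by apply: vcross_parallel; apply: perp; eassumption.
have par' : vscale (vdot n n) u' = vscale (vdot u' n) n.
  by apply: vcross_parallel; apply: perp; eassumption.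
have sq : U * vdot n n = vdot u n ^+ 2.
  by have := congr1 (vdot u) par; rewrite !vdotZr -/U mulrC expr2.
have sq' : U' * vdot n n = vdot u' n ^+ 2.
  by have := congr1 (vdot u') par'; rewrite !vdotZr -/U' mulrC expr2.
have onn (p q x : pt3 R) : vdot q q != 0 -> vscale (vdot n n) q = vscale (vdot q n) n ->
    vdot (vsub x p) q = 0 -> vdot (vsub x p) n = 0.
  move=> q0 pq xq; have := congr1 (vdot (vsub x p)) pq.
  rewrite !vdotZr xq mulr0 => /esym/eqP; rewrite mulf_eq0 => /orP[/eqP qn|/eqP //].
  have := congr1 (vdot q) pq; rewrite qn !vdotZr mul0r.
  by move/eqP; rewrite mulf_eq0 (gt_eqF nn) (negbTE q0).
have oE : o' = o.
  apply: vsub_eq0; apply: (@vcross_orthogonal _ _ (vsub c2 c1) (vsub c3 c1)) => //.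
  - have -> : vdot (vsub o' o) (vsub c2 c1) = (vdot (vsub c2 o) (vsub c2 o) - vdot (vsub c1 o) (vsub c1 o)
       - (vdot (vsub c2 o') (vsub c2 o') - vdot (vsub c1 o') (vsub c1 o'))) / 2.
      by rewrite /vdot /=; field.
    by rewrite H1 H2 H1' H2'; ring.
  - have -> : vdot (vsub o' o) (vsub c3 c1) = (vdot (vsub c3 o) (vsub c3 o) - vdot (vsub c1 o) (vsub c1 o)
       - (vdot (vsub c3 o') (vsub c3 o') - vdot (vsub c1 o') (vsub c1 o'))) / 2.
      by rewrite /vdot /=; field.
    by rewrite H1 H3 H1' H3'; ring.
  - rewrite -/n; have -> : vdot (vsub o' o) n = vdot (vsub c1 o) n - vdot (vsub c1 o') n.
      by rewrite /vdot /=; ring.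
    by rewrite (onn o u c1) // (onn o' u' c1) // subrr.
have UU : U = U'.
  by have : (rho - kap ^+ 2) * U = (rho - kap ^+ 2) * U';
    [rewrite -H1 -H1' oE | apply: mulfI; rewrite subr_eq0 gt_eqF].
move=> sgn.
have nE : vdot u n = vdot u' n.
  have : (vdot u n - vdot u' n) * (vdot u n + vdot u' n) = 0.
    by rewrite -subr_sqr -sq -sq' UU subrr.
  move/eqP; rewrite mulf_eq0 => /orP[|/eqP H]; first by rewrite subr_eq0 => /eqP.
  by move: sgn; case: (lerP 0 (vdot u n)) => h /esym; [|move/negbT; rewrite -ltNge]; lra.
have uu : u = u'.
  by apply: (vscale_inj (t := vdot n n)); rewrite ?gt_eqF // par par' nE.
have aE : a = a'.
  have -> : a = vsub o (vscale kap u) by apply: pt3P; rewrite /o /u /=; ring.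
  by rewrite -oE uu; apply: pt3P; rewrite /o' /u' /=; ring.
split=> //.
have -> : b = vadd a u by apply: pt3P; rewrite /u /=; ring.
by rewrite uu aE; apply: pt3P; rewrite /u' /=; ring.
Qed.

Lemma sim_dots a b c : sim a b c -> let w := vsub a c in let y := vsub b c in
  let U := vdot (vsub b a) (vsub b a) in
  [/\ vdot w w = rho * U, vdot y w = (rho - kap) * U & vdot y y = (1 - 2 * kap + rho) * U].
Proof.
case/and3P => _ /eqP H1 /eqP H2 w y U.
have -> : vdot w w = vdot (vsub c a) (vsub c a) by rewrite /vdot /=; ring.
have -> : vdot y w = vdot (vsub c a) (vsub c a) - vdot (vsub b a) (vsub c a).
  by rewrite /vdot /=; ring.
have -> : vdot y y = vdot (vsub c a) (vsub c a) - 2 * vdot (vsub b a) (vsub c a) + U.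
  by rewrite /U /vdot /=; ring.
by rewrite H1 H2 -/U; split=> //; ring.
Qed.

(** The vector [w x (g x w)] is [|w|^2] times the component of [g] orthogonal to [w]. *)
Definition plane_side (g w y : pt3 R) : bool := 0 <= vdot y (vcross w (vcross g w)).

Lemma second_vertex_unique a b b' c g : sim a b c -> sim a b' c ->
  vdot g (vcross (vsub a c) (vsub b c)) = 0 -> vdot g (vcross (vsub a c) (vsub b' c)) = 0 ->
  vcross (vsub a c) g != (0, 0, 0) ->
  plane_side g (vsub a c) (vsub b c) = plane_side g (vsub a c) (vsub b' c) -> b = b'.
Proof.
move=> /sim_dots[w1 y1 z1] /sim_dots[w2 y2 z2] gy gy' n0 side.
have UU : vdot (vsub b a) (vsub b a) = vdot (vsub b' a) (vsub b' a).
  by apply: (mulfI (x := rho)); rewrite ?gt_eqF ?rho_gt0 // -w1 -w2.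
have : vsub b c = vsub b' c.
  by apply: (coplanar_unique n0) => //; rewrite ?y1 ?y2 ?z1 ?z2 ?UU.
by case=> /addIr h1 /addIr h2 /addIr h3; apply: pt3P.
Qed.

Lemma first_vertex_unique a a' b c g : sim a b c -> sim a' b c ->
  vdot g (vcross (vsub a c) (vsub b c)) = 0 -> vdot g (vcross (vsub a' c) (vsub b c)) = 0 ->
  vcross (vsub b c) g != (0, 0, 0) ->
  plane_side g (vsub b c) (vsub a c) = plane_side g (vsub b c) (vsub a' c) -> a = a'.
Proof.
move=> /sim_dots[w1 y1 z1] /sim_dots[w2 y2 z2] gy gy' n0 side.
(* This is the squared ratio of bc to ab, equal to [(1 - kap)^2 + (rho - kap^2)]. *)
have k0 : 1 - 2 * kap + rho != 0.
  by rewrite gt_eqF //; have := sqr_ge0 (1 - kap); have := kap_rho; nra.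
have UU : vdot (vsub b a) (vsub b a) = vdot (vsub b a') (vsub b a').
  by apply: (mulfI k0); rewrite -z1 -z2.
have anti (p q : pt3 R) : vdot g (vcross p q) = - vdot g (vcross q p).
  by rewrite /vdot /vcross /=; ring.
have : vsub a c = vsub a' c.
  apply: (coplanar_unique n0) => //.
  - by rewrite anti gy oppr0.
  - by rewrite anti gy' oppr0.
  - by rewrite ![vdot _ (vsub b c)]vdotC y1 y2 UU.
  - by rewrite w1 w2 UU.
by case=> /addIr h1 /addIr h2 /addIr h3; apply: pt3P.
Qed.

(** Otherwise [a - c] and [b - c] are parallel, and the tangent vector at [c] vanishes. *)
Lemma not_both_parallel a b c g : sim a b c -> g != (0, 0, 0) ->
  vcross (vsub a c) g = (0, 0, 0) -> vcross (vsub b c) g != (0, 0, 0).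
Proof.
move=> abc g0 wg; apply/eqP => yg; case/eqP: (tangent_neq0 kap_rho abc).
have gg : vdot g g != 0 by apply: contraNneq g0 => /vdot_eq0 ->.
have along (p : pt3 R) : vcross p g = (0, 0, 0) -> vscale (vdot g g) p = vscale (vdot p g) g.
  move=> pg; have -> : vscale (vdot g g) p = vadd (vscale (vdot p g) g) (vcross g (vcross p g)).
    by apply: pt3P; rewrite /vdot /vcross /=; ring.
  by rewrite pg; apply: pt3P; rewrite /vcross /=; ring.
apply: (vscale_inj gg); apply: (vscale_inj gg).
have -> : vscale (vdot g g) (vscale (vdot g g) (vcross (vsub a c) (vsub b c))) =
    vcross (vscale (vdot g g) (vsub a c)) (vscale (vdot g g) (vsub b c)).
  by apply: pt3P; rewrite /vcross /=; ring.
by rewrite (along _ wg) (along _ yg); apply: pt3P; rewrite /vcross /=; ring.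
Qed.

End Uniqueness.

(** * Counting incidences *)

Lemma sum_card_pair (A B : finType) (P : pred A) (Q : A -> pred B) :
  (\sum_(a | P a) #|[pred b | Q a b]| = #|[pred ab : A * B | P ab.1 && Q ab.1 ab.2]|)%N.
Proof.
rewrite -sum1_card (eq_bigr (fun a => \sum_(b | Q a b) 1)%N); last first.
  by move=> a _; rewrite -sum1_card; apply: eq_bigl => b; rewrite inE.
by rewrite pair_big_dep /=; apply: eq_bigl => ab; rewrite inE.
Qed.

Lemma card_inj_le (A B : finType) (P : pred A) (Q : pred B) (f : A -> B) :
  {in P &, injective f} -> (forall a, P a -> Q (f a)) -> (#|P| <= #|Q|)%N.
Proof.
move=> inj PQ; rewrite -(card_in_imset inj); apply: subset_leq_card.
by apply/subsetP => b /imsetP[a aP ->]; apply: PQ.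
Qed.

(* Two points x, y of each class are discarded, the others are counted by
   the triples (x, y, z). *)
Lemma card_le_triples (T : finType) (S : pred T) q (idx : T -> 'I_q) :
  (#|S| <= 2 * q + #|[pred t : T * T * T | [&& S t.1.1, S t.1.2, S t.2,
     t.1.1 != t.1.2, t.1.1 != t.2, t.1.2 != t.2, idx t.1.1 == idx t.1.2 & idx t.1.1 == idx t.2]]|)%N.
Proof.
set Tr := [pred t | _].
pose Si i := [pred x | S x && (idx x == i)].
pose Tri i := [pred t | Tr t && (idx t.1.1 == i)].
have -> : #|S| = (\sum_(i < q) #|Si i|)%N.
  rewrite (sum_card_pair xpredT) -(card_imset S (f := fun x => (idx x, x))); last by move=> x y [].
  apply: eq_card => -[i x]; rewrite !inE /=; apply/imsetP/andP => [[y yS [-> ->]]|[xS /eqP <-]].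
    by split.
  by exists x.
have -> : #|Tr| = (\sum_(i < q) #|Tri i|)%N.
  rewrite (sum_card_pair xpredT) -(card_imset Tr (f := fun t => (idx t.1.1, t))); last by move=> x y [].
  apply: eq_card => -[i x]; rewrite !inE /=; apply/imsetP/andP => [[y yS [-> ->]]|[xS /eqP <-]].
    by split.
  by exists x.
have -> : (2 * q = \sum_(i < q) 2)%N by rewrite sum_nat_const card_ord mulnC.
rewrite -big_split /=; apply: leq_sum => i _.
have [le2|] := leqP #|Si i| 2; first exact: leq_trans (leq_addr _ _).
move=> gt2.
have [x xS] : exists x, x \in Si i by apply/card_gt0P; apply: leq_trans gt2.
have cx : #|Si i| = (1 + #|[predD1 Si i & x]|)%N by rewrite (cardD1 x (Si i)) xS.
have [y yS] : exists y, y \in [predD1 Si i & x].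
  by apply/card_gt0P; move: gt2; rewrite cx add1n ltnS => /(leq_trans _); apply.
have cy : #|[predD1 Si i & x]| = (1 + #|[predD1 [predD1 Si i & x] & y]|)%N.
  by rewrite (cardD1 y [predD1 Si i & x]) yS.
rewrite cx cy; move: yS; rewrite inE => /andP[yx yS].
rewrite addnA leq_add2l; apply: (@card_inj_le _ _ _ _ (fun z => (x, y, z))) => [z z' _ _ []//|z].
rewrite !inE => /and3P[zy zx /andP[zS /eqP zi]] /=.
move: xS yS; rewrite !inE => /andP[xS /eqP xi] /andP[yS /eqP yi].
by rewrite /Tr /= xS yS zS xi yi zi !eqxx [x == y]eq_sym yx [x == z]eq_sym zx [y == z]eq_sym zy.
Qed.

Lemma count_lt (T : Type) (p1 p2 : pred T) (r : seq T) : subpred p1 p2 ->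
  has [pred x | p2 x && ~~ p1 x] r -> (count p1 r < count p2 r)%N.
Proof.
move=> sub; elim: r => //= x r IH.
have le : (count p1 r <= count p2 r)%N by apply: sub_count.
case/orP => [/andP[-> /negbTE ->]|/IH lt]; first by rewrite add0n add1n ltnS.
by rewrite -addnS leq_add //; case: (p1 x) (sub x) => // ->.
Qed.

Section Counting.
Variables (R : realType) (kap rho : R).
Hypothesis kap_rho : kap ^+ 2 < rho.
Variables (T : finType) (pts : T -> pt3 R).
Hypothesis pts_inj : injective pts.
Let sim a b c := simtri kap rho (pts a) (pts b) (pts c).
Let S (p : T * T) : pred T := fun c => sim p.1 p.2 c.
Let contained (f : pol3 R) (p : T * T) :=
  `[< forall y, simtri kap rho (pts p.1) (pts p.2) y -> peval f y = 0 >].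

Lemma roots_le (A : pred T) (s : pt3 R -> R) (G : {poly R}) : G != 0 ->
  {in A &, injective (s \o pts)} -> (forall c, A c -> root G (s (pts c))) ->
  (#|A| <= (size G).-1)%N.
Proof.
move=> G0 inj rt; rewrite cardE -(size_map (s \o pts)).
rewrite -ltnS prednK ?size_poly_gt0 //; apply: max_poly_roots => //.
  by apply/allP => x /mapP[c + ->]; rewrite mem_enum => /rt.
rewrite map_inj_in_uniq ?enum_uniq // => x y; rewrite !mem_enum; exact: inj.
Qed.

Lemma at_point_le (z : pt3 R) (A : pred T) :
  (#|A| <= 1 + #|[pred c | A c && (pts c != z)]|)%N.
Proof.
rewrite -(cardID [pred c | pts c == z] A) leq_add //.
  apply/card_le1_eqP => x y; rewrite !inE => /andP[_ /eqP zx] /andP[_ /eqP zy].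
  by apply: pts_inj; rewrite zx zy.
by apply: subset_leq_card; apply/subsetP => c; rewrite !inE andbC.
Qed.

(** At most [2 * pdeg f] roots in the chart, and the one point that the chart misses. *)
Lemma zeros_le p f : ~~ contained f p ->
  (#|[pred c | S p c && (peval f (pts c) == 0%R)]| <= (2 * pdeg f).+1)%N.
Proof.
move=> ncont; set Z := [pred c | _].
have [->//|/card_gt0P[c0]] := posnP #|Z|; rewrite !inE => /andP[Sc0 _].
have [s [z [inj chart]]] := circle_chart kap_rho Sc0.
apply: leq_trans (at_point_le z Z) _; rewrite add1n ltnS.
have G0 : chart_poly kap (pts p.1) (pts p.2) (pts c0) f != 0.
  apply: contraNneq ncont => G0; apply/asboolP.
  exact: (chart_poly_eq0 kap_rho Sc0 G0).
have sz := size_chart_poly kap (pts p.1) (pts p.2) (pts c0) f.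
apply: leq_trans (roots_le (s := s) G0 _ _) _; last first.
- by move: sz; case: (size _).
- move=> c; rewrite !inE /= => /andP[/andP[Sc /eqP fc] cz].
  by have [e _ He] := chart f _ Sc cz; rewrite /root He fc mulr0.
move=> c c'; rewrite !inE /= => /andP[/andP[Sc _] cz] /andP[/andP[Sc' _] cz'] ss.
by apply: pts_inj; apply: inj ss.
Qed.

(** If [a - c] is not parallel to [g], then [a] and one side bit determine [b]; otherwise [b - c] is
    not parallel to [g], and [b] with a bit determines [a]. *)
Lemma tangent_pairs_le (c : T) (g : pt3 R) : g != (0, 0, 0) ->
  (#|[pred p | S p c &&
      (vdot g (vcross (vsub (pts p.1) (pts c)) (vsub (pts p.2) (pts c))) == 0%R)]| <= 4 * #|T|)%N.
Proof.
move=> g0.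
pose ca a := vsub (pts a) (pts c).
pose f p : (T * bool) + (T * bool) :=
  if vcross (ca p.1) g != (0, 0, 0) then inl (p.1, plane_side g (ca p.1) (ca p.2))
  else inr (p.2, plane_side g (ca p.2) (ca p.1)).
have -> : (4 * #|T| = #|{: (T * bool) + (T * bool)}|)%N by rewrite card_sum !card_prod card_bool; lia.
apply: (card_inj_le (f := f)) => // -[a b] [a' b']; rewrite !inE /= => /andP[s1 /eqP t1] /andP[s2 /eqP t2].
rewrite /f /=; case: eqP => wg; case: eqP => wg' //= [].
- move=> bE; rewrite bE in s1 t1 *; move=> side; congr (_, _).
  by apply: pts_inj; apply: (first_vertex_unique kap_rho s1 s2 t1 t2 _ side);
    apply: not_both_parallel s2 _ wg'.
- move=> aE; rewrite aE in s1 t1 wg *; move=> side; congr (_, _).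
  by apply: pts_inj; apply: (second_vertex_unique kap_rho s1 s2 t1 t2 _ side); apply/eqP.
Qed.

(** Double counting by [c]: at such a point the gradient of [f] is nonzero and orthogonal to the
    tangent of the circle. *)
Lemma tangent_incidences_le (P : pred (T * T)) (f g : pol3 R) :
  (forall p, P p -> contained f p) ->
  (forall y, peval g y != 0 -> (peval (pdx f) y, peval (pdy f) y, peval (pdz f) y) != (0, 0, 0)) ->
  (\sum_(p | P p) #|[pred c | S p c && (peval g (pts c) != 0%R)]| <= 4 * #|T| ^ 2)%N.
Proof.
move=> Pf Hg; rewrite sum_card_pair.
pose swap (pc : (T * T) * T) := (pc.2, pc.1).
pose grad c := (peval (pdx f) (pts c), peval (pdy f) (pts c), peval (pdz f) (pts c)).
pose Q c p := S p c && (vdot (grad c) (vcross (vsub (pts p.1) (pts c)) (vsub (pts p.2) (pts c))) == 0).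
apply: (@leq_trans (\sum_(c | peval g (pts c) != 0%R) #|[pred p | Q c p]|)).
  rewrite sum_card_pair; apply: (card_inj_le (f := swap)) => [[? ?] [? ?] _ _ [-> ->] //|].
  move=> [p c]; rewrite !inE /= => /and3P[/Pf /asboolP cont Sc gc].
  by rewrite gc /Q Sc /=; apply/eqP; exact: (gradient_tangent Sc cont).
apply: (@leq_trans (\sum_(c : T) 4 * #|T|)); last first.
  by rewrite sum_nat_const mulnCA expnS expn1.
by rewrite big_mkcond; apply: leq_sum => c _; case: ifP => // /Hg g0; apply: tangent_pairs_le.
Qed.

Lemma exists_nonzero_partial (f : pol3 R) : nonzero3 f -> (exists q, peval f q = 0) ->
  exists2 g, g \in [:: pdx f; pdy f; pdz f] & nonzero3 g.
Proof.
move=> [p fp] [q fq]; apply: contrapT => noz.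
have z g r : g \in [:: pdx f; pdy f; pdz f] -> peval g r = 0.
  by move=> gin; apply: contrapT => /eqP gr; apply: noz; exists g => //; exists r.
have const : forall r, peval f r = peval f (0, 0, 0).
  by apply: peval_const => r; apply: z; rewrite !inE eqxx ?orbT.
by case/eqP: fp; rewrite const -(const q).
Qed.

Lemma partial_eq0 (f g : pol3 R) : (pdeg f <= 0)%N -> g \in [:: pdx f; pdy f; pdz f] ->
  ~ nonzero3 g.
Proof.
move=> f0 gin [q /eqP]; apply; move: gin.
have z t : t \in f -> [/\ t.2.1.1 = 0, t.2.1.2 = 0 & t.2.2 = 0]%N.
  by move=> /mem_pdeg /leq_trans /(_ f0); case: t => ? [[[|?] [|?]] [|?]].
by rewrite !inE => /or3P[] /eqP ->; rewrite ?(peval_pdx, peval_pdy, peval_pdz) big_seq;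
  apply: big1 => t /z[h1 h2 h3]; rewrite ?h1 ?h2 ?h3; ring.
Qed.

(* Induction on the degree through a nonzero partial derivative g: a circle in
   Z(f) is either in Z(g), or has few points on Z(g), and at its other points
   it is tangent to Z(f) with nonzero gradient. *)
Lemma contained_incidences_le m (P : pred (T * T)) (f : pol3 R) :
  (pdeg f <= m)%N -> nonzero3 f -> (forall p, P p -> contained f p) ->
  (\sum_(p | P p) #|S p| <= 4 * m * #|T| ^ 2 + 2 * m * #|P|)%N.
Proof.
elim: m P f => [|m IH] P f fm nzf Pf.
(* Without incidences the sum is 0; otherwise a point on some circle is a zero of [f], so [f] is not
   constant. *)
all: have [/existsP[p /andP[Pp /existsP[c Sc]]]|nonempty] := boolP [exists p, P p && [exists c, S p c]];
  last by rewrite big1 // => q Pq; apply: eq_card0 => d; apply: contraNF nonempty => Sd;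
    apply/existsP; exists q; rewrite Pq; apply/existsP; exists d.
all: have [g gin nzg] := exists_nonzero_partial nzf (ex_intro _ (pts c) (asboolW (Pf p Pp) _ Sc)).
  by case: (partial_eq0 fm gin nzg).
have gm : (pdeg g <= m)%N.
  by have [? ? ?] := pdeg_partials fm; move: gin; rewrite !inE => /or3P[] /eqP ->.
have grad y : peval g y != 0 -> (peval (pdx f) y, peval (pdy f) y, peval (pdz f) y) != (0, 0, 0).
  by move=> gy; apply: contraNneq gy => -[h1 h2 h3]; move: gin; rewrite !inE => /or3P[] /eqP ->; apply/eqP.
pose P2 := [pred p | P p && contained g p]; pose P1 := [pred p | P p && ~~ contained g p].
have cardP : #|P| = (#|P2| + #|P1|)%N.
  rewrite -(cardID (contained g) P); congr (_ + _)%N; apply: eq_card => t; rewrite !inE //.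
  by rewrite andbC.
have sum2 := IH P2 g gm nzg.
rewrite (bigID (contained g)) /= cardP.
have sum1 : (\sum_(p | P p && ~~ contained g p) #|S p| <= (2 * m).+1 * #|P1| + 4 * #|T| ^ 2)%N.
  apply: (@leq_trans (\sum_(p | P1 p) ((2 * m).+1 + #|[pred c | S p c && (peval g (pts c) != 0%R)]|))).
    apply: leq_sum => t /andP[_ npg].
    rewrite -(cardID [pred c | peval g (pts c) == 0%R] (S t)) leq_add //.
      apply: leq_trans (_ : (2 * pdeg g).+1 <= _)%N; last by rewrite ltnS leq_mul2l gm orbT.
      apply: leq_trans (zeros_le npg); apply: subset_leq_card.
      by apply/subsetP => d; rewrite !inE.
    by apply: subset_leq_card; apply/subsetP => d; rewrite !inE andbC.
  rewrite big_split /= leq_add //; first by rewrite sum_nat_const mulnC leqnn.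
  by apply: (@tangent_incidences_le _ f g) => // t /andP[/Pf].
have {}sum2 := sum2 (fun p => @proj2 _ _ \o elimT andP).
apply: leq_trans (leq_add sum2 sum1) _.
move: (#|T| ^ 2)%N #|P1| #|P2| => N a b; nia.
Qed.

(** In the chart the product of the polynomials has at most [2 D] roots, which cut the line into
    [2 D + 1] intervals, each inside one cell. The count is 1 for the missed point, [2 D] for the
    roots, two per interval, and the triples. *)
Lemma crossing_le (fs : seq (pol3 R)) p (D := (\sum_(f <- fs) pdeg f)%N) :
  (forall f, f \in fs -> ~~ contained f p) ->
  (#|S p| <= 6 * D + 3 + #|[pred t : T * T * T | [&& S p t.1.1, S p t.1.2, S p t.2,
     t.1.1 != t.1.2, t.1.1 != t.2, t.1.2 != t.2,
     same_cell fs (pts t.1.1) (pts t.1.2) & same_cell fs (pts t.1.1) (pts t.2)]]|)%N.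
Proof.
move=> ncont; set Tr := [pred t | _].
have [->//|/card_gt0P[c0 Sc0]] := posnP #|S p|.
have [s [z [inj chart]]] := circle_chart kap_rho Sc0.
pose G f := chart_poly kap (pts p.1) (pts p.2) (pts c0) f.
have G0 f : f \in fs -> G f != 0.
  move=> /ncont; apply: contraNneq => Gf0; apply/asboolP.
  exact: (chart_poly_eq0 kap_rho Sc0 Gf0).
pose H := \prod_(f <- fs) G f.
have H0 : H != 0.
  by rewrite /H prodf_seq_neq0; apply/allP => f ff /=; apply: G0.
have szH : (size H <= (2 * D).+1)%N.
  rewrite /H /D; elim: (fs) => [|f l IH]; first by rewrite !big_nil size_poly1.
  rewrite !big_cons; apply: leq_trans (size_polyMleq _ _) _.
  have := size_chart_poly kap (pts p.1) (pts p.2) (pts c0) f; rewrite -/(G f).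
  by move: (size (G f)) (size (\prod_(j <- l) G j)) (pdeg f) IH => a b d; lia.
pose rs := rootsR H.
have rsP x : (x \in rs) = root H x by rewrite -(roots_on_rootsR H0) in_itv.
have szrs : (size rs <= 2 * D)%N.
  rewrite -ltnS; apply: leq_trans szH; apply: max_poly_roots => //.
    by apply/allP => x; rewrite rsP.
  exact: uniq_roots.
(* The interval is indexed by the number of roots to its left. *)
pose idx c : 'I_(2 * D).+1 := inord (count (fun r => r < s (pts c)) rs).
have idxE c : idx c = count (fun r => r < s (pts c)) rs :> nat.
  by rewrite inordK // ltnS (leq_trans (count_size _ _)).
have sinj : {in [pred c | S p c && (pts c != z)] &, injective (s \o pts)}.
  move=> c c'; rewrite !inE => /andP[Sc cz] /andP[Sc' cz'] ss.
  by apply: pts_inj; apply: inj ss.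
pose A := [pred c | (S p c && (pts c != z)) && ~~ root H (s (pts c))].
have mono c c' : A c -> A c' -> idx c = idx c' -> s (pts c) < s (pts c') ->
    same_cell fs (pts c) (pts c').
  rewrite /A /= => /andP[/andP[Sc cz] rc] /andP[/andP[Sc' cz'] rc'] /(congr1 val) /=.
  rewrite !idxE => ii lt; apply/allP => f ff.
  have [e e0 He] := chart f _ Sc cz; have [e' e'0 He'] := chart f _ Sc' cz'.
  have divH x : root (G f) x -> root H x.
    by move=> rx; rewrite /H (big_rem f) //= rootM rx.
  have nz : (G f).[s (pts c)] != 0 by apply: contraNneq rc => h; apply: divH; rewrite /root h.
  have nz' : (G f).[s (pts c')] != 0 by apply: contraNneq rc' => h; apply: divH; rewrite /root h.
  have : 0 < (G f).[s (pts c)] * (G f).[s (pts c')].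
    rewrite lt_def mulf_neq0 // leNgt; apply/negP => neg.
    (* A sign change would put a root between the two parameters, making their indices differ. *)
    have [r rin /divH rr] := poly_ivtoo (ltW lt) neg.
    move: rin; rewrite in_itv /= => /andP[lr rl].
    suff : (count (fun r => (r < s (pts c))%R) rs < count (fun r => (r < s (pts c'))%R) rs)%N.
      by rewrite ii ltnn.
    apply: count_lt; first by move=> x /lt_trans; apply.
    by apply/hasP; exists r; rewrite ?rsP //= rl -leNgt ltW.
  by rewrite /G He He' mulrACA (pmulr_rgt0 _ (mulr_gt0 e0 e'0)).
have step1 : (#|S p| <= 1 + (2 * D + #|A|))%N.
  apply: leq_trans (at_point_le z (S p)) _; rewrite leq_add2l.
  rewrite -(cardID [pred c | root H (s (pts c))]) leq_add //.
    apply: leq_trans (roots_le (s := s) H0 _ _) _.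
    - by move=> c c'; rewrite !inE => /andP[h _] /andP[h' _]; apply: sinj; rewrite inE.
    - by move=> c; rewrite !inE => /andP[].
    - by move: szH; case: (size H).
  by apply: subset_leq_card; apply/subsetP => c; rewrite !inE andbC.
have := card_le_triples A idx; set Tr' := [pred t | _] => step2.
have step3 : (#|Tr'| <= #|Tr|)%N.
  apply: subset_leq_card; apply/subsetP => -[[x y] w].
  rewrite /Tr' /Tr !inE /= => /and5P[Ax Ay Aw xy /and4P[xw yw /eqP ixy /eqP ixw]].
  have cellA c c' : A c -> A c' -> c != c' -> idx c = idx c' -> same_cell fs (pts c) (pts c').
    move=> Ac Ac' cc' ii; case: (ltgtP (s (pts c)) (s (pts c'))) => [|gt|eq].
    - exact: mono.
    - have := mono _ _ Ac' Ac (esym ii) gt.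
      by rewrite /same_cell => /allP h; apply/allP => f ff; rewrite mulrC; apply: h.
    - case/eqP: cc'; apply: sinj eq; rewrite !inE.
        by move: Ac => /andP[].
      by move: Ac' => /andP[].
  have Sof c : A c -> S p c by move=> /andP[/andP[]].
  by rewrite !Sof // xy xw yw !cellA.
move: step1 step2 step3; move: #|S p| #|A| #|Tr| #|Tr'| => a b c d; lia.
Qed.

(** Circles inside some zero set cost [6 D n^2], the others [(6 D + 3) n^2] plus their triples
    inside cells, where each triple is counted for at most two pairs. *)
Lemma triangle_count (fs : seq (pol3 R)) (D := (\sum_(f <- fs) pdeg f)%N) :
  (forall f, f \in fs -> nonzero3 f) ->
  (\sum_p #|S p| <= (12 * D + 3) * #|T| ^ 2 +
     2 * \sum_x #|fun y => same_cell fs (pts x) (pts y)| ^ 2)%N.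
Proof.
move=> nz.
have cardTT : #|{: T * T}| = (#|T| ^ 2)%N by rewrite card_prod expnS expn1.
rewrite (bigID (fun p => has (contained ^~ p) fs)) /=.
have first : (\sum_(p | has (contained ^~ p) fs) #|S p| <= 6 * D * #|T| ^ 2)%N.
  apply: (@leq_trans (\sum_(f <- fs) \sum_(p | contained f p) #|S p|)%N).
    rewrite (eq_bigr (fun f => \sum_p (contained f p) * #|S p|)%N); last first.
      by move=> f _; rewrite big_mkcond; apply: eq_bigr => p _; case: (contained f p); rewrite ?mul1n.
    rewrite exchange_big big_mkcond; apply: leq_sum => p _; case: ifP => // /hasP[f ff cf].
    by rewrite (big_rem f) //= cf mul1n leq_addr.
  rewrite /D big_distrr big_distrl /= !big_seq; apply: leq_sum => f ff.
  apply: leq_trans (@contained_incidences_le (pdeg f) _ f (leqnn _) (nz f ff) (fun p => id)) _.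
  have : (#|contained f| <= #|T| ^ 2)%N by rewrite -cardTT max_card.
  by move: #|contained f| (#|T| ^ 2)%N (pdeg f) => a b d; nia.
pose Tr p := [pred t : T * T * T | [&& S p t.1.1, S p t.1.2, S p t.2,
     t.1.1 != t.1.2, t.1.1 != t.2, t.1.2 != t.2,
     same_cell fs (pts t.1.1) (pts t.1.2) & same_cell fs (pts t.1.1) (pts t.2)]].
have second : (\sum_(p | ~~ has (contained ^~ p) fs) #|S p| <= (6 * D + 3) * #|T| ^ 2 + \sum_p #|Tr p|)%N.
  apply: (@leq_trans (\sum_p (6 * D + 3 + #|Tr p|))%N); last first.
    by rewrite big_split /= sum_nat_const cardTT mulnC.
  rewrite big_mkcond; apply: leq_sum => p _; case: ifP => // /hasPn h; exact: crossing_le.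
have third : (\sum_p #|Tr p| <= 2 * \sum_x #|fun y => same_cell fs (pts x) (pts y)| ^ 2)%N.
  pose Q := [pred tb : T * (T * T) * bool | same_cell fs (pts tb.1.1) (pts tb.1.2.1)
                                          && same_cell fs (pts tb.1.1) (pts tb.1.2.2)].
  have -> : (2 * \sum_x #|fun y => same_cell fs (pts x) (pts y)| ^ 2 = #|Q|)%N.
    pose Q1 := [pred t : T * (T * T) | same_cell fs (pts t.1) (pts t.2.1)
                                          && same_cell fs (pts t.1) (pts t.2.2)].
    have -> : #|Q| = (#|Q1| * 2)%N.
      rewrite -card_bool -cardX; apply: eq_card => -[t b]; rewrite !inE /= andbT //.
    rewrite mulnC -(sum_card_pair xpredT (fun x yz => same_cell fs (pts x) (pts yz.1) && same_cell fs (pts x) (pts yz.2))).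
    congr (_ * _)%N; apply: eq_bigr => x _.
    by rewrite expnS expn1 -cardX; apply: eq_card => -[y w]; rewrite !inE.
  rewrite (sum_card_pair xpredT).
  pose nrm (t : T * T * T) := vcross (vsub (pts t.1.2) (pts t.1.1)) (vsub (pts t.2) (pts t.1.1)).
  (* The bit orients [b - a] against the normal of the triple, which tells apart the two pairs
     sharing it. *)
  pose f (pt : (T * T) * (T * T * T)) : T * (T * T) * bool :=
    ((pt.2.1.1, (pt.2.1.2, pt.2.2)), 0 <= vdot (vsub (pts pt.1.2) (pts pt.1.1)) (nrm pt.2)).
  apply: (card_inj_le (f := f)); last first.
    by move=> [p t]; rewrite /Q /Tr !inE /= => /and5P[_ _ _ _ /and4P[_ _ -> ->]].
  move=> [[a b] [[x y] w]] [[a' b'] [[x' y'] w']]; rewrite !inE /=.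
  move=> /and5P[s1 s2 s3 d12 /and4P[d13 d23 _ _]] /and5P[s1' s2' s3' _ /and4P[_ _ _ _]].
  rewrite /f /= => -[ex ey ew]; rewrite -ex -ey -ew in s1' s2' s3' *; rewrite /nrm /= => side.
  have ne (i j : T) : i != j -> pts i != pts j by apply: contraNneq => /pts_inj ->.
  have [/pts_inj /= -> /pts_inj /= ->] := circle_determined kap_rho s1 s2 s3 s1' s2' s3' (ne _ _ d12) (ne _ _ d13) (ne _ _ d23) side.
  by [].
apply: leq_trans (leq_add first second) _.
apply: (@leq_trans (6 * D * #|T| ^ 2 + ((6 * D + 3) * #|T| ^ 2
    + 2 * \sum_x #|fun y => same_cell fs (pts x) (pts y)| ^ 2))%N).
  by rewrite !leq_add2l.
by rewrite addnA -mulnDl leq_add2r leq_mul2r; apply/orP; right; lia.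
Qed.

End Counting.

(** The balance: for [n] of order [128^J], the degree term [2^J n^2] and the triples [n^3 / 64^J]
    have the same order, as [128 = 64 * 2]. *)
Lemma similar_incidences (R : realType) : exists C, forall (kap rho : R) (T : finType)
    (pts : T -> pt3 R) J,
  kap ^+ 2 < rho -> injective pts -> (#|T| <= 128 * 128 ^ J)%N ->
  (#|[pred t : T * T * T | simtri kap rho (pts t.1.1) (pts t.1.2) (pts t.2)]|
    <= C * 2 ^ J * #|T| ^ 2)%N.
Proof.
have [C HC] := polynomial_partition R.
exists (12 * C + 259)%N => kap rho T pts J kr inj nJ.
have [fs [dfs nz Efs]] := HC T pts J.
have := triangle_count kr inj nz.
rewrite (sum_card_pair xpredT (fun p c => simtri kap rho (pts p.1) (pts p.2) (pts c))) /=.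
move/leq_trans; apply; move: Efs; set E := (\sum_x _)%N; set D := (\sum_(f <- fs) _)%N in dfs *.
have e64 : (128 ^ J = 64 ^ J * 2 ^ J)%N by rewrite -expnMn.
rewrite e64 in nJ => Efs.
have p64 : (0 < 64 ^ J)%N by rewrite expn_gt0.
have p2 : (0 < 2 ^ J)%N by rewrite expn_gt0.
have E128 : (E <= 128 * 2 ^ J * #|T| ^ 2)%N.
  rewrite -(leq_pmul2l p64); apply: leq_trans Efs _; rewrite expnS.
  move: (64 ^ J)%N (2 ^ J)%N (#|T| ^ 2)%N nJ => a b N nJ.
  by rewrite !mulnA leq_mul2r [(a * 128)%N]mulnC -mulnA nJ orbT.
move: (2 ^ J)%N (#|T| ^ 2)%N p2 dfs E128 => b N p2 dfs E128.
apply: (@leq_trans ((12 * (C * b) + 3 * b) * N + 2 * (128 * b * N))).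
  by apply: leq_add; rewrite ?leq_mul2l ?E128 // leq_mul2r; apply/orP; right;
    apply: leq_add; rewrite ?leq_mul2l ?dfs // leq_pmulr.
by apply: eq_leq; ring.
Qed.

(** * From distances and lists of triangles to coordinates *)

Lemma dist3_sqr (p q : point) : (dist3 p q) ^+ 2 = vdot (vsub q p) (vsub q p).
Proof.
case: p q => [[x1 y1] z1] [[x2 y2] z2].
rewrite /dist3 !RpowE !RplusE !RminusE RsqrtE /vdot /vsub /= sqr_sqrtr; last first.
  by rewrite !addr_ge0 ?sqr_ge0.
by ring.
Qed.

Lemma dist3C (p q : point) : dist3 p q = dist3 q p.
Proof.
case: p q => [[x1 y1] z1] [[x2 y2] z2].
by rewrite /dist3 !RpowE !RplusE !RminusE; congr R_sqrt.sqrt; ring.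
Qed.

(* Heron: 16 area^2 = (al+be+ga)(al+ga-be)(be+al-ga)(be+ga-al) > 0. *)
Lemma similarity_parameters (D : tri) : nondegenerate D ->
  exists kap rho : Rdefinitions.R, kap ^+ 2 < rho /\
    forall a b c, similar_labelled (a, b, c) D -> simtri kap rho a b c.
Proof.
case: D => [[p q] r] /= [/RltP h1 [/RltP h2 /RltP h3]].
rewrite !RplusE in h1 h2 h3.
set al := dist3 p q in h1 h2 h3 *; set be := dist3 q r in h1 h2 h3 *.
set ga := dist3 r p; rewrite (dist3C p r) (dist3C r q) (dist3C q p) in h1 h2 h3.
rewrite -/al -/be -/ga in h1 h2 h3.
have al0 : 0 < al by lra.
have ga0 : 0 < ga by lra.
have al2 : al ^+ 2 != 0 by rewrite expf_neq0 // gt_eqF.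
pose k := (al ^+ 2 + ga ^+ 2 - be ^+ 2) / (2 * al ^+ 2).
pose rh := ga ^+ 2 / al ^+ 2.
exists k, rh; split.
  rewrite -subr_gt0.
  have -> : rh - k ^+ 2 =
     ((al + ga + be) * (al + ga - be) * ((be + al - ga) * (be + ga - al))) / (4 * al ^+ 4).
    by rewrite /rh /k; field; rewrite gt_eqF.
  rewrite divr_gt0 ?mulr_gt0 ?exprn_gt0 //; lra.
move=> a b c [lam [/RltP lam0 [ab [bc ca]]]]; rewrite RmultE -/al in ab; rewrite RmultE -/be in bc.
rewrite RmultE -/ga in ca.
have AB := dist3_sqr a b; have BC := dist3_sqr b c; have CA := dist3_sqr c a.
rewrite ab in AB; rewrite bc in BC; rewrite ca in CA.
have CA' : (lam * ga) ^+ 2 = vdot (vsub c a) (vsub c a).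
  by rewrite CA /vdot /vsub /=; ring.
have dotE : vdot (vsub b a) (vsub c a) =
    ((lam * al) ^+ 2 + (lam * ga) ^+ 2 - (lam * be) ^+ 2) / 2.
  by rewrite AB BC CA /vdot /vsub /=; field.
have lam2 : lam != 0 by rewrite gt_eqF.
apply/and3P; split; rewrite -?AB -?CA' ?dotE.
- by rewrite expf_neq0 // mulf_neq0 // gt_eqF.
- by apply/eqP; rewrite /k; field; rewrite gt_eqF.
- by apply/eqP; rewrite /rh; field; rewrite gt_eqF.
Qed.

Section Lists.
Variables (T : finType) (pts : T -> point) (P : list point).
Hypothesis pts_surj : forall p, List.In p P -> exists i, pts i = p.
Let tri_of (t : T * T * T) : tri := (pts t.1.1, pts t.1.2, pts t.2).

(** Each triangle is relabelled so as to match [D] and replaced by indices of its vertices; distinct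
    vertex sets give distinct index triples. *)
Lemma length_le_card (Q : pred (T * T * T)) (L : list tri) (D : tri) :
  (forall t, similar_labelled (tri_of t) D -> Q t) ->
  List.Forall (fun t => List.incl (verts t) P /\ similar t D) L ->
  List.ForallOrdPairs (fun t u => ~ Permutation.Permutation (verts t) (verts u)) L ->
  (length L <= #|Q|)%N.
Proof.
move=> HQ HL HO.
suff [M [szM uM HM]] : exists M : seq (T * T * T), [/\ size M = length L, uniq M &
    forall m, m \in M -> Q m /\ exists2 t, List.In t L & Permutation.Permutation (verts t) (verts (tri_of m))].
  by rewrite -szM cardE; apply: uniq_leq_size => // m /HM[Qm _]; rewrite mem_enum.
elim: L HL HO => [|t L IH] HL HO; first by exists [::]; split.
inversion HL as [|t' L' [tP [t2 [perm sim]]] HL']; inversion HO as [|t'' L'' tL HO']; subst.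
have [M [szM uM HM]] := IH HL' HO'.
have inP x : List.In x (verts t2) -> List.In x P.
  by move=> xt2; apply: tP; apply: Permutation.Permutation_in (Permutation.Permutation_sym perm) xt2.
case: t2 perm sim inP => [[a b] c] perm sim inP.
have [i ei] := pts_surj (inP a (or_introl erefl)).
have [j ej] := pts_surj (inP b (or_intror (or_introl erefl))).
have [k ek] := pts_surj (inP c (or_intror (or_intror (or_introl erefl)))).
have mE : tri_of (i, j, k) = (a, b, c) by rewrite /tri_of /= ei ej ek.
exists ((i, j, k) :: M); split => /=; first by rewrite szM.
- rewrite uM andbT; apply/negP => /HM[_ [t3 t3L perm3]].
  move: tL => /List.Forall_forall /(_ t3 t3L); apply.
  apply: Permutation.Permutation_trans perm _; apply: Permutation.Permutation_sym.
  by move: perm3; rewrite /tri_of /= ei ej ek.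
- move=> m; rewrite inE => /orP[/eqP ->|/HM[Qm [t3 t3L perm3]]].
    split; first by apply: HQ; rewrite mE.
    by exists t; [left | rewrite /tri_of /= ei ej ek].
  by split => //; exists t3 => //; right.
Qed.

End Lists.

Lemma points_of_list (P : list point) : List.NoDup P -> exists pts : 'I_(length P) -> point,
  injective pts /\ forall p, List.In p P -> exists i, pts i = p.
Proof.
move=> nd; exists (fun i : 'I_(length P) => List.nth i P (Rdefinitions.R0, Rdefinitions.R0, Rdefinitions.R0)); split.
  move=> i j /= ij; apply: val_inj => /=.
  by apply: (List.NoDup_nth P (Rdefinitions.R0, Rdefinitions.R0, Rdefinitions.R0)).1 ij => //; apply/ssrnat.ltP.
move=> p /(List.In_nth P p (Rdefinitions.R0, Rdefinitions.R0, Rdefinitions.R0))[n [/ssrnat.ltP nP <-]].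
by exists (Ordinal nP).
Qed.

(* The exponent 15/7 *)
From Stdlib Require Import Reals Lra List Permutation.
Import ListNotations.
Open Scope R_scope.

(** Meant for [y = 2^J] and [x = n] with [128^J <= n]; the exponent splits as [15/7 = 1/7 + 2]. *)
Lemma pow_le_Rpower (x y : R) : 0 < x -> 0 < y -> y ^ 7 <= x ->
  y * x ^ 2 <= Rpower x (15 / 7).
Proof.
move=> x0 y0 yx.
have -> : 15 / 7 = 1 / 7 + INR 2 by rewrite /=; Lra.lra.
rewrite Rpower_plus Rpower_pow //.
apply: Rmult_le_compat_r; first by apply: pow_le; Lra.lra.
have -> : y = Rpower (y ^ 7) (1 / 7).
  rewrite -Rpower_pow // Rpower_mult.
  have -> : INR 7 * (1 / 7) = 1 by rewrite /=; Lra.lra.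
  by rewrite Rpower_1.
apply: Rle_Rpower_l; first by Lra.lra.
by split; [apply: pow_lt |].
Qed.

(* For a fixed non-degenerate triangle D there is a constant C such that for
   every set P of n points in R^3 (a duplicate-free list), any family L of
   pairwise distinct triangles (distinct vertex sets) with vertices in P, all
   similar to D, has at most C * n^(15/7) members. *)
Theorem theorem3p1 :
  forall D : tri, nondegenerate D ->
  exists C : R, 0 < C /\
    forall (P : list point) (L : list tri),
      NoDup P ->
      Forall (fun t => incl (verts t) P /\ similar t D) L ->
      ForallOrdPairs (fun t u => ~ Permutation (verts t) (verts u)) L ->
      INR (length L) <= C * Rpower (INR (length P)) (15 / 7).
Proof.
move=> D nd.
have [kap [rho [kr Hsim]]] := similarity_parameters nd.
have [C HC] := similar_incidences (Rdefinitions.R : realType).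
(* The successor ensures a positive constant. *)
exists (INR C.+1); split; first by apply: lt_0_INR; apply/ssrnat.ltP.
move=> P L ndP HL HO.
have [pts [inj surj]] := points_of_list ndP.
have Q := length_le_card surj (fun t => Hsim _ _ _) HL HO.
(* Without points [L] is empty; the case is separate because the logarithm bounds require a positive
   [n]. *)
have [n0|n0] := posnP (length P).
  have -> : length L = 0%nat.
    case: (L) HL => // -[[a b] c] L' HL.
    by have [/(_ a (or_introl erefl)) + _] := Forall_inv HL; case: (P) n0.
  by apply: Rmult_le_pos; [apply: pos_INR | apply: Rlt_le; apply: exp_pos].
(* The stage [J] satisfies [128^J <= n < 128^(J+1)], so [2^J] is the integral stand-in for
   [n^(1/7)]. *)
have [lo up] := andP (trunc_log_bounds (isT : is_true (leq 2 128)) n0).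
set J := trunc_log _ _ in lo up.
have {}Q : is_true (leq (length L) (muln (muln C (expn 2 J)) (expn (length P) 2))).
  apply: leq_trans Q _; have := HC kap rho _ pts J kr inj; rewrite card_ord; apply.
  by rewrite -expnS ltnW.
apply: (Rle_trans _ (INR C * (INR (expn 2 J) * INR (length P) ^ 2))).
  have -> : INR C * (INR (expn 2 J) * INR (length P) ^ 2) =
      INR (muln (muln C (expn 2 J)) (expn (length P) 2)).
    by rewrite !INRE RpowE !RmultE [in RHS]natrM [in RHS]natrM !natrX mulrA.
  by apply: le_INR; apply/ssrnat.leP.
have n0R : 0 < INR (length P) by apply: lt_0_INR; apply/ssrnat.ltP.
apply: Rmult_le_compat; first exact: pos_INR.
- by apply: Rmult_le_pos; [apply: pos_INR | apply: pow_le; apply: Rlt_le].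
- by apply: le_INR; apply/ssrnat.leP.
apply: pow_le_Rpower => //; first by apply: lt_0_INR; apply/ssrnat.ltP; rewrite expn_gt0.
apply/RleP; rewrite RpowE !INRE -natrX ler_nat -expnM mulnC expnM; exact: lo.
Qed.
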